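(* Let $R>1$, $\Omega=B_R\subset\mathbb{R}^3$ and $D=B_1\subset\mathbb{R}^3$ (open balls centered at the origin of radius $R$ and $1$). Then there exist eigenfunctions $\mathbf{E}$, with nonzero eigenvalue $\lambda_0$, satisfying $$\nabla\times\nabla\times\mathbf{E}=\lambda_0\,1_D\,\mathbf{E}\ \text{ in }\Omega,\qquad\mathbf{E}\times\nu_\Omega=0\ \text{ on }\partial\Omega,$$ that are not electrostatic, that is, the magnetic field $\mathbf{H}=\nabla\times\mathbf{E}$ does not identically vanish in $\Omega\setminus\overline D$.
   Context: $1_D$ is the indicator function of $D$ and $\nu_\Omega$ is the outward unit normal to $\Omega$. The equation is understood weakly: $\mathbf{E}\in H_0(\mathrm{curl},\Omega)=\{f\in L^2(\Omega)^3:\nabla\times f\in L^2(\Omega)^3,\ \nu_\Omega\times f=0\text{ on }\partial\Omega\}$, $\mathbf{E}\neq0$, and $\int_\Omega\nabla\times\mathbf{E}\cdot\overline{\nabla\times\mathbf{F}}\,dx=\lambda_0\int_D\mathbf{E}\cdot\overline{\mathbf{F}}\,dx$ for all $\mathbf{F}\in H_0(\mathrm{curl},\Omega)$. *)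

(* Defs.v *)
From HB Require Import structures.
From mathcomp Require Import all_boot all_order all_algebra.
From mathcomp Require Import complex.
From mathcomp Require Import all_classical all_reals all_analysis.

Set Implicit Arguments.
Unset Strict Implicit.
Unset Printing Implicit Defensive.

Import Order.TTheory GRing.Theory Num.Theory.
Import numFieldNormedType.Exports.

Local Open Scope classical_set_scope.
Local Open Scope ring_scope.
Local Open Scope complex_scope.

(* Points of R^3 are triples ((x_0, x_1), x_2), a type that carries both the
   product sigma-algebra and a normed space structure.  Its library norm is the
   sup norm, hence the separate Euclidean norm [enorm]. *)
Definition enorm (R : realType) (x : R * R * R) : R :=
  Num.sqrt (x.1.1 ^+ 2 + x.1.2 ^+ 2 + x.2 ^+ 2).

Definition eball (R : realType) (r : R) : set (R * R * R) :=
  [set x | enorm x < r].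

(* The two-dimensional factor is named so as to carry the sigma-finite
   structure that Fubini's theorem for [leb3] requires. *)
Definition leb2 (R : realType) :
    set (measurableTypeR R * measurableTypeR R) -> \bar R :=
  (@lebesgue_measure R \x @lebesgue_measure R)%E.

HB.instance Definition _ (R : realType) := Measure.on (@leb2 R).

Lemma leb2_sigma_finite (R : realType) : sigma_finite setT (@leb2 R).
Proof.
have /sigma_finiteP[F [FT ndF Foo]] := sigma_finiteT (@lebesgue_measure R).
exists (fun n => F n `*` F n).
  rewrite -setXTT FT predeqE => -[x y]; split.
    move=> [/= [n _ Fnx] [k _ Fky]]; exists (maxn n k) => //; split.
    - by move: x Fnx; exact/subsetPset/ndF/leq_maxl.
    - by move: y Fky; exact/subsetPset/ndF/leq_maxr.
  by move=> [n _ []/= ? ?]; split; exists n.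
move=> k; have [? ?] := Foo k; split; first exact: measurableX.
by rewrite /leb2 product_measure1E// lte_mul_pinfty// ge0_fin_numE.
Qed.

HB.instance Definition _ (R : realType) :=
  Measure_isSigmaFinite.Build _ _ _ (@leb2 R) (@leb2_sigma_finite R).

Definition leb3 (R : realType) :
    set (measurableTypeR R * measurableTypeR R * measurableTypeR R) -> \bar R :=
  (@leb2 R \x @lebesgue_measure R)%E.

HB.instance Definition _ (R : realType) := Measure.on (@leb3 R).

Definition basis3 (R : realType) (i : 'I_3) : R * R * R :=
  ((i == 0%N :> nat)%:R, (i == 1%N :> nat)%:R, (i == 2%N :> nat)%:R).

Definition partial (R : realType) (i : 'I_3) (f : R * R * R -> R) :
    R * R * R -> R :=
  fun x => 'D_(basis3 R i) f x.

(* Every iterated partial derivative is differentiable everywhere, i.e.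
   f is C^oo. *)
Definition smooth (R : realType) (f : R * R * R -> R) : Prop :=
  forall (s : seq 'I_3) (x : R * R * R),
    differentiable (foldr (@partial R) f s) x.

(* Index arithmetic is that of Z/3Z. *)
Definition curl (R : realType) (phi : R * R * R -> 'rV[R]_3) :
    R * R * R -> 'rV[R]_3 :=
  fun x => \row_(i < 3)
    (partial (i + 1) (fun y => phi y ord0 (i + 1 + 1)) x
     - partial (i + 1 + 1) (fun y => phi y ord0 (i + 1)) x).

(* C_c^oo(U)^3, real-valued. *)
Definition test_field (R : realType) (U : set (R * R * R))
    (phi : R * R * R -> 'rV[R]_3) : Prop :=
  [/\ forall i : 'I_3, smooth (fun x => phi x ord0 i),
      compact (closure [set x | phi x != 0]) &
      closure [set x | phi x != 0] `<=` U].

Definition cintegral (R : realType) (A : set (R * R * R))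
    (f : R * R * R -> R[i]) : R[i] :=
  Rintegral (@leb3 R) A (fun x => complex.Re (f x)) +i*
  Rintegral (@leb3 R) A (fun x => complex.Im (f x)).

(* The bilinear product E . phi with a real vector, and the sesquilinear
   product E . conj(F). *)
Definition rdot (R : realType) (u : 'rV[R[i]]_3) (v : 'rV[R]_3) : R[i] :=
  \sum_(i < 3) u ord0 i * (v ord0 i)%:C.

Definition hdot (R : realType) (u v : 'rV[R[i]]_3) : R[i] :=
  \sum_(i < 3) u ord0 i * conjc (v ord0 i).

(* L^2(Om)^3.  The restriction f \_ Om is f on Om and 0 elsewhere. *)
Definition L2field (R : realType) (Om : set (R * R * R))
    (E : R * R * R -> 'rV[R[i]]_3) : Prop :=
  forall i : 'I_3,
    ((fun x => complex.Re (E x ord0 i)) \_ Om \in Lfun (@leb3 R) 2%:E) /\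
    ((fun x => complex.Im (E x ord0 i)) \_ Om \in Lfun (@leb3 R) 2%:E).

Definition ae_zero (R : realType) (A : set (R * R * R))
    (E : R * R * R -> 'rV[R[i]]_3) : Prop :=
  {ae (@leb3 R), forall x, A x -> E x = 0}.

(* H = curl E in the sense of distributions on Om; since elements of L^2 are
   functions up to null sets, the curl is a relation rather than a function. *)
Definition weak_curl (R : realType) (Om : set (R * R * R))
    (E H : R * R * R -> 'rV[R[i]]_3) : Prop :=
  forall phi, test_field Om phi ->
    cintegral Om (fun x => rdot (H x) (phi x)) =
    cintegral Om (fun x => rdot (E x) (curl phi x)).

(* The tangential trace nu x E on the boundary of Om, for H = curl E, is the
   functional defined by Green's formula
     <nu x E, phi> = int_Om (curl E . phi - E . curl phi),
   here tested against fields phi that are smooth up to the boundary (the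
   restrictions to Om of C_c^oo(R^3)^3, dense in H^1(Om)^3). *)
Definition tangential_trace (R : realType) (Om : set (R * R * R))
    (E H : R * R * R -> 'rV[R[i]]_3) (phi : R * R * R -> 'rV[R]_3) : R[i] :=
  cintegral Om (fun x => rdot (H x) (phi x) - rdot (E x) (curl phi x)).

(* E belongs to H_0(curl, Om) and H = curl E. *)
Definition H0curl (R : realType) (Om : set (R * R * R))
    (E H : R * R * R -> 'rV[R[i]]_3) : Prop :=
  [/\ L2field Om E,
      L2field Om H,
      weak_curl Om E H &
      forall phi, test_field setT phi -> tangential_trace Om E H phi = 0].

(* E <> 0 is a weak solution of curl curl E = lam 1_D E in Om with
   E x nu = 0 on the boundary of Om, and H = curl E. *)
Definition eigenfunction (R : realType) (Om D : set (R * R * R)) (lam : R[i])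
    (E H : R * R * R -> 'rV[R[i]]_3) : Prop :=
  [/\ H0curl Om E H,
      ~ ae_zero Om E &
      forall F G, H0curl Om F G ->
        cintegral Om (fun x => hdot (H x) (G x)) =
        lam * cintegral D (fun x => hdot (E x) (F x))].

(* Main.v *)
Require Import Defs.
From mathcomp Require Import all_boot all_order all_algebra.
From mathcomp Require Import complex.
From mathcomp Require Import all_classical all_reals all_analysis.
From mathcomp Require Import measurable_realfun ring lra.

(** The eigenfunctions are transverse electric modes
      E = h(|x|^2) (e_3 x x),     e_3 x x = (- x_2, x_1, 0),
    whose curl is H = 2 h e_3 + 2 h' (|x|^2 e_3 - x_3 x) and whose double curl
    is again of the same form, with h replaced by - (4 q h'' + 10 h'), q being
    |x|^2 (curl_toroidal, curl_poloidal). Being tangent to the spheres, E meets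
    the boundary condition as soon as h vanishes at q = R^2, and the equation
    becomes an ordinary one: 4 q h'' + 10 h' equals - lambda h for q < 1 and 0
    for 1 < q < R^2, while h and h' match at q = 1.

    In the shell, h = b (q^(-3/2) - c) with c = R^(-3), so that h' has no zero
    there; the first component of H is - 2 h' x_1 x_3, hence H is not zero in
    the shell. In the unit ball, h(q) = - 6 S'(lambda q), where S is the entire
    function with S(s^2) = sin(s) / s. Matching at q = 1 fixes b and leaves one
    condition on the frequency, (1 - c) S(lambda) = 6 c S'(lambda). The
    difference of its two sides changes sign between pi^2 and (3 pi / 2)^2,
    where S and S' are explicit, which gives lambda (exists_frequency,
    exists_profile).

    It remains to pass to the weak formulation, in which test fields are smooth
    with compact support, whereas h is only of class C^1, piecewise smooth. The
    two smooth pieces of h agree to first order at q = 1, so that a smooth step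
    applied to their difference in a shrinking interval at the left of 1 yields
    smooth h_n which have uniformly bounded first and second derivatives and
    which, at each point, end up coinciding with h together with these
    derivatives (blend_bounded, blend_near). All limits below are therefore
    instances of dominated convergence.

    That E has no tangential trace and that H is its weak curl both say that
    the integral of H . phi - E . curl phi over the ball vanishes for smooth
    phi. Once the h_n have also been cut off below q = R^2, this is Green's
    formula for smooth fields of compact support (green), obtained from
    Fubini's theorem and the fundamental theorem of calculus, and it passes to
    the limit (mode_trace).

    Now let F be a test field of the weak equation, with weak curl G. The
    vanishing of its tangential trace may be tested with the fields
    phi_n = curl(h_n (e_3 x x)), the h_n being cut off beyond the ball this
    time. In the limit phi_n and its curl become H and lambda 1_D E, and the
    identity obtained is the weak equation for E tested with F (mode_eigen). It
    is applied to the real and to the imaginary part of F. *)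

Set Implicit Arguments.
Unset Strict Implicit.
Unset Printing Implicit Defensive.

Import Order.TTheory GRing.Theory Num.Theory.
Import numFieldNormedType.Exports.

Local Open Scope classical_set_scope.
Local Open Scope ring_scope.

(** * Smooth functions of one real variable *)

Section OneVariable.
Variable R : realType.
Implicit Types (f g : R -> R) (a b x t : R).

(** Locking keeps algebraic normalization from unfolding the limit that defines
    the derivative. *)
Definition der f : R -> R := locked (@derive1 R R) f.

Lemma derE f x : der f x = 'D_1 f x.
Proof. by rewrite /der -lock derive1E. Qed.

(** Asking for n successive derivatives, rather than for the differentiability
    of a canonical iterated derivative, makes the closure properties below plain
    inductions on n. *)
Fixpoint Ck (n : nat) f : Prop :=
  if n is m.+1 then
    exists2 f', (forall x, is_derive x (1 : R) f (f' x)) & Ck m f'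
  else True.

Definition Cinf f : Prop := forall n, Ck n f.

(** A class of functions closed under differentiation consists of smooth
    functions: this is how power series are handled. *)
Lemma Cinf_coind (P : (R -> R) -> Prop) :
  (forall f, P f ->
     exists2 f', (forall x, is_derive x (1 : R) f (f' x)) & P f') ->
  forall f, P f -> Cinf f.
Proof.
move=> step f Pf n; elim: n f Pf => [//|n IH] f /step[f' ff' Pf'] /=.
by exists f' => //; exact: IH.
Qed.

Lemma Cinf_is_derive f : Cinf f ->
  forall x, is_derive x (1 : R) f (der f x).
Proof.
move=> Cf x; have [f' ff' _] := Cf 1%N.
by rewrite derE; apply: derivableP; have [] := ff' x.
Qed.

Lemma Cinf_der f : Cinf f -> Cinf (der f).
Proof.
move=> Cf n; have [f' ff' Cf'] := Cf n.+1.
suff -> : der f = f' by [].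
by apply/funext => x; rewrite derE; apply: derive_val.
Qed.

Lemma Cinf_of_der f f' : (forall x, is_derive x (1 : R) f (f' x)) ->
  Cinf f' -> Cinf f.
Proof. by move=> ff' Cf' [|n] //=; exists f'. Qed.

Lemma Ck_pred n f : Ck n.+1 f -> Ck n f.
Proof.
elim: n f => [//|n IH] f [f' ff' Cf'].
by exists f' => //; exact: IH.
Qed.

Lemma Cinf_cst a : Cinf (fun=> a).
Proof.
apply: (@Cinf_coind (fun f => exists b, f = fun=> b)); last by exists a.
by move=> f [b ->]; exists (fun=> 0); [move=> x; exact: is_derive_cst|exists 0].
Qed.

Lemma Cinf_id : Cinf id.
Proof.
by apply: (@Cinf_of_der _ (fun=> 1)) (Cinf_cst 1) => x; exact: is_derive_id.
Qed.

Lemma CkD n f g : Ck n f -> Ck n g -> Ck n (fun x => f x + g x).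
Proof.
elim: n f g => [//|n IH] f g [f' df Cf] [g' dg Cg].
by exists (fun x => f' x + g' x) => [x|]; [exact: is_deriveD|exact: IH].
Qed.

Lemma CkM n f g : Ck n f -> Ck n g -> Ck n (fun x => f x * g x).
Proof.
elim: n f g => [//|n IH] f g Cf Cg.
have [f' df Cf'] := Cf; have [g' dg Cg'] := Cg.
exists (fun x => f x * g' x + g x * f' x) => [x|]; first exact: is_deriveM.
by apply: CkD; apply: IH => //; exact: Ck_pred.
Qed.

Lemma Ck_comp n f g : Ck n f -> Ck n g -> Ck n (fun x => f (g x)).
Proof.
elim: n f g => [//|n IH] f g Cf Cg.
have [f' df Cf'] := Cf; have [g' dg Cg'] := Cg.
exists (fun x => f' (g x) * g' x) => [x|].
  exact: is_derive1_comp.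
by apply: CkM => //; apply: IH => //; exact: Ck_pred.
Qed.

Lemma CinfD f g : Cinf f -> Cinf g -> Cinf (fun x => f x + g x).
Proof. by move=> Cf Cg n; exact: CkD. Qed.

Lemma CinfM f g : Cinf f -> Cinf g -> Cinf (fun x => f x * g x).
Proof. by move=> Cf Cg n; exact: CkM. Qed.

Lemma Cinf_comp f g : Cinf f -> Cinf g -> Cinf (fun x => f (g x)).
Proof. by move=> Cf Cg n; exact: Ck_comp. Qed.

Lemma CinfZ a f : Cinf f -> Cinf (fun x => a * f x).
Proof. by move=> Cf; apply: CinfM => //; exact: Cinf_cst. Qed.

Lemma CinfB f g : Cinf f -> Cinf g -> Cinf (fun x => f x - g x).
Proof.
move=> Cf Cg; rewrite (_ : (fun _ => _) = (fun x => f x + (-1) * g x)).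
  by apply: CinfD => //; exact: CinfZ.
by apply/funext => x; rewrite mulN1r.
Qed.

(** The induction on the number of derivatives has to treat all exponents
    together, since differentiation lowers the exponent. The exponent - 1 gives
    the smoothness of quotients. *)
Lemma Cinf_powR f a : Cinf f -> (forall x, 0 < f x) ->
  Cinf (fun x => f x `^ a).
Proof.
move=> Cf f0 n; elim: n a => [//|n IH] a.
have [f' df Cf'] := Cf n.+1.
exists (fun x => (a * f x `^ (a - 1)) * f' x) => [x|].
  have dp := is_derive1_powR a (f0 x).
  exact: (@is_derive1_comp _ (@powR R ^~ a) f).
by apply: CkM => //; apply: CkM => //; exact: Cinf_cst.
Qed.

Lemma Cinf_continuous f : Cinf f -> continuous f.
Proof.
move=> Cf x; apply/differentiable_continuous/derivable1_diffP.
by have [] := Cinf_is_derive Cf x.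
Qed.

End OneVariable.

Section Deriv.
Variable R : realType.
Implicit Types (f g : R -> R) (a b x : R).

Lemma is_derive1_eq f x a b : is_derive x (1 : R) f a -> a = b ->
  is_derive x (1 : R) f b.
Proof. by move=> ? <-. Qed.

Lemma is_derive1_mul f g x a b : is_derive x (1 : R) f a -> is_derive x (1 : R) g b ->
  is_derive x (1 : R) (fun y => f y * g y) (f x * b + g x * a).
Proof. by move=> df dg; exact: is_deriveM. Qed.

Lemma is_derive1_add f g x a b : is_derive x (1 : R) f a -> is_derive x (1 : R) g b ->
  is_derive x (1 : R) (fun y => f y + g y) (a + b).
Proof. by move=> df dg; exact: is_deriveD. Qed.

Lemma is_derive1_scale c f x a : is_derive x (1 : R) f a ->
  is_derive x (1 : R) (fun y => c * f y) (c * a).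
Proof. by move=> df; exact: is_deriveZ. Qed.

Lemma is_derive1_chain f g x a b : is_derive x (1 : R) g b ->
  is_derive (g x) (1 : R) f a -> is_derive x (1 : R) (fun y => f (g y)) (a * b).
Proof. by move=> dg df; exact: is_derive1_comp. Qed.

Lemma is_derive1_unique f x a b :
  is_derive x (1 : R) f a -> is_derive x (1 : R) f b -> a = b.
Proof. by move=> [_ <-] [_ <-]. Qed.

Lemma is_derive1_cst c x : is_derive x (1 : R) (fun=> c : R) 0.
Proof. exact: is_derive_cst. Qed.

Lemma is_derive1_sqr x : is_derive x (1 : R) (fun y => y ^+ 2) (2 * x).
Proof.
have := is_derive1_mul (is_derive_id x (1 : R)) (is_derive_id x (1 : R)).
by move=> d; apply: is_derive1_eq d _; ring.
Qed.

Lemma is_derive1_affine a b x : is_derive x (1 : R) (fun y => a * y + b) a.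
Proof.
have d := is_derive1_add (is_derive1_scale a (is_derive_id x (1 : R))) (is_derive1_cst b x).
by apply: is_derive1_eq d _; ring.
Qed.

End Deriv.

(** * A smooth step *)

Section Step.
Variable R : realType.
Implicit Types (f g : R -> R) (a b x t : R).

(** t^(-k) exp(- 1 / t) on the positive reals, extended by 0. The whole family
    is needed since the derivative of the function of index k combines those of
    index k + 1 and k + 2. *)
Definition flat k t : R := if 0 < t then t^-1 ^+ k * expR (- t^-1) else 0.

(** With u = 1 / t this is u^k / k! <= exp u. *)
Lemma flat_le_fact k t : 0 <= flat k t <= k`!%:R.
Proof.
rewrite /flat; case: ifPn => [t0|_]; last by rewrite lexx ler0n.
have u0 : 0 < t^-1 by rewrite invr_gt0.
apply/andP; split; first by rewrite mulr_ge0 ?expR_ge0// exprn_ge0// ltW.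
rewrite expRN ler_pdivrMr ?expR_gt0// mulrC -ler_pdivrMr ?ltr0n ?fact_gt0//.
case: k => [|k]; first by rewrite expr0 divr1 -expR0 ler_expR ltW.
by rewrite (le_trans _ (expR_ge1Dxn k (ltW u0)))// lerDr.
Qed.

(** Read from right to left twice, this shows that the function of index k is
    O(t^2) at 0, the one of index k + 2 being bounded. *)
Lemma flat_shift k t : t * flat k.+1 t = flat k t.
Proof.
rewrite /flat; case: ifPn => t0; last by rewrite mulr0.
by rewrite exprS mulrA mulrA divff ?mul1r// gt_eqF.
Qed.

Lemma is_derive_flat k t :
  is_derive t (1 : R) (flat k) (- k%:R * flat k.+1 t + flat k.+2 t).
Proof.
have [t0|t0|->] := ltgtP t 0.
- rewrite /flat ltNge ltW//= mulr0 addr0.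
  apply: near_eq_is_derive (is_derive_cst _ _ _).
  by near=> s; rewrite /cst ltNge ltW//=; near: s; exact: lt_nbhsl.
- have tn0 : t != 0 by rewrite gt_eqF.
  have dV : is_derive t 1 (@GRing.inv R) (- t^-1 ^+ 2).
    apply: is_derive_eq; first exact: (@is_deriveV _ id t 1 1 tn0).
    by rewrite exprVn [_ *: _]mulr1.
  have dE : is_derive t 1 (fun s => expR (- s^-1)) (expR (- t^-1) * t^-1 ^+ 2).
    have dN := is_deriveN dV.
    have := is_derive1_comp (is_derive_expR _) dN.
    by rewrite opprK.
  have dX := is_deriveX k dV.
  have := is_deriveM dX dE.
  rewrite (_ : _ * _ = (fun s => s^-1 ^+ k * expR (- s^-1))); last first.
    by apply/funext => s; rewrite !fctE.
  move=> dXE; have nE : \near t, t^-1 ^+ k * expR (- t^-1) = flat k t.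
    by near=> s; rewrite /flat ifT//; near: s; exact: lt_nbhsr.
  have dflat := near_eq_is_derive nE dXE.
  apply: (is_derive1_eq dflat).
  rewrite /flat t0 /GRing.scale/= exprfctE.
  (* The derivative of t^(-k) involves k.-1, whence the two cases. *)
  case: k {dX dXE nE dflat} => [|k]; first by rewrite /= !expr0 mulr0n !mul0r; ring.
  by rewrite /= !exprS -mulr_natr; ring.
- rewrite [X in is_derive _ _ _ X](_ : _ = 0); last first.
    by rewrite /flat ltxx mulr0 addr0.
  (* The difference quotient at 0 is h times the function of index k + 2. *)
  have : (fun h => h^-1 *: (flat k (h *: 1 + 0) - flat k 0)) @ 0^' --> 0.
    apply/cvgrPdist_le => e e0; near=> h.
    have hn0 : h != 0 by near: h; exact: nbhs_dnbhs_neq.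
    rewrite sub0r normrN [h *: 1]mulr1 addr0 {2}/flat ltxx subr0.
    rewrite -flat_shift -flat_shift [h^-1 *: _]mulrA mulVf// mul1r normrM.
    rewrite (@le_trans _ _ (`|h| * k.+2`!%:R))//.
      apply: ler_wpM2l => //; case/andP: (flat_le_fact k.+2 h) => a0 a1.
      by rewrite ger0_norm.
    rewrite -ler_pdivlMr ?ltr0n ?fact_gt0//.
    near: h; apply: dnbhs0_le; by rewrite divr_gt0// ltr0n fact_gt0.
  move=> H; apply: DeriveDef; first by apply/cvg_ex; exists 0.
  exact/cvg_lim.
Unshelve. all: by end_near. Qed.

Lemma Cinf_flat k : Cinf (flat k).
Proof.
move=> n; elim: n k => [//|n IH] k /=.
exists (fun t => - k%:R * flat k.+1 t + flat k.+2 t); first exact: is_derive_flat.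
by apply: CkD => //; apply: CkM => //; exact: Cinf_cst.
Qed.

(** The quotient psi(t) / (psi(t) + psi(1 - t)) for psi(t) = exp(- 1 / t), which
    is 0 for t <= 0 and 1 for t >= 1. It is locked because its unfolding makes
    comparisons of terms costly. *)
Definition step : R -> R :=
  locked (fun t => flat 0 t * (flat 0 t + flat 0 (1 - t)) `^ (-1)).

Lemma stepE t : step t = flat 0 t * (flat 0 t + flat 0 (1 - t)) `^ (-1).
Proof. by rewrite /step -lock. Qed.

Lemma flat0_gt0 t : 0 < t -> 0 < flat 0 t.
Proof. by move=> t0; rewrite /flat t0 expr0 mul1r expR_gt0. Qed.

Lemma step_den_gt0 t : 0 < flat 0 t + flat 0 (1 - t).
Proof.
have [/andP[a0 _] /andP[b0 _]] := (flat_le_fact 0 t, flat_le_fact 0 (1 - t)).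
have [t0|t0] := ltP 0 t; first by rewrite ltr_pwDl// flat0_gt0.
by rewrite ltr_wpDl// flat0_gt0//; lra.
Qed.

Lemma Cinf_step : Cinf step.
Proof.
rewrite (funext stepE).
apply: CinfM; first exact: Cinf_flat.
apply: Cinf_powR step_den_gt0.
apply: CinfD; first exact: Cinf_flat.
apply: Cinf_comp; first exact: Cinf_flat.
by apply: CinfB; [exact: Cinf_cst|exact: Cinf_id].
Qed.

Lemma step_le0 t : t <= 0 -> step t = 0.
Proof. by move=> t0; rewrite stepE /flat ltNge t0/= mul0r. Qed.

Lemma step_ge1 t : 1 <= t -> step t = 1.
Proof.
move=> t1; have t0 : 0 < t by lra.
rewrite stepE {3}/flat (_ : 0 < 1 - t = false) ?addr0; last by apply/negbTE; lra.
by rewrite powR_inv1 ?ltW ?flat0_gt0// divff// gt_eqF// flat0_gt0.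
Qed.

Lemma step_ge0 t : 0 <= step t.
Proof. by rewrite stepE mulr_ge0 ?powR_ge0//; case/andP: (flat_le_fact 0 t). Qed.

Lemma step_le1 t : step t <= 1.
Proof.
rewrite stepE powR_inv1; last exact/ltW/step_den_gt0.
rewrite ler_pdivrMr ?step_den_gt0// mul1r lerDl.
by case/andP: (flat_le_fact 0 (1 - t)).
Qed.

Lemma der_eq_lt f g x a : (forall t, t < a -> f t = g t) -> x < a ->
  der f x = der g x.
Proof.
move=> fg xa; rewrite !derE; apply: near_eq_derive.
by near=> s; apply: fg; near: s; exact: lt_nbhsl.
Unshelve. all: by end_near. Qed.

Lemma der_eq_gt f g x a : (forall t, a < t -> f t = g t) -> a < x ->
  der f x = der g x.
Proof.
move=> fg ax; rewrite !derE; apply: near_eq_derive.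
by near=> s; apply: fg; near: s; exact: lt_nbhsr.
Unshelve. all: by end_near. Qed.

Lemma der_cst_lt f c a : (forall t, t < a -> f t = c) ->
  forall t, t < a -> der f t = 0.
Proof.
move=> fc t ta; rewrite (der_eq_lt (g := fun=> c) fc ta) derE.
exact: derive_cst.
Qed.

Lemma der_cst_gt f c a : (forall t, a < t -> f t = c) ->
  forall t, a < t -> der f t = 0.
Proof.
move=> fc t ta; rewrite (der_eq_gt (g := fun=> c) fc ta) derE.
exact: derive_cst.
Qed.

Lemma bounded_on_segment f a b : continuous f ->
  exists2 M, 0 <= M & forall t, a <= t <= b -> `|f t| <= M.
Proof.
move=> cf; have [ab|ba] := leP a b; last first.
  by exists 0 => // t /andP[at_ tb]; move: (le_lt_trans (le_trans at_ tb) ba);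
     rewrite ltxx.
have cnf : {within `[a, b], continuous (fun t => `|f t|)}.
  by apply: continuous_subspaceT => x; apply: cvg_norm; exact: cf.
have [c _ H] := EVT_max ab cnf.
by exists `|f c| => // t tab; apply: H; rewrite in_itv.
Qed.

(** The derivatives of the step vanish off [0, 1]. The weights t and t^2 are the
    ones which make the bounds invariant under rescaling of the variable. *)
Lemma der_step_bounded : exists2 K, 0 <= K & forall t,
  `|t * der step t| <= K /\ `|t ^+ 2 * der (der step) t| <= K.
Proof.
have C1 := Cinf_der Cinf_step; have C2 := Cinf_der C1.
have c1 := Cinf_continuous C1; have c2 := Cinf_continuous C2.
have [M1 M10 H1] := bounded_on_segment 0 1 c1.
have [M2 M20 H2] := bounded_on_segment 0 1 c2.
have z1 t : t < 0 -> der step t = 0.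
  by apply: (@der_cst_lt _ 0) => s s0; rewrite step_le0// ltW.
have z2 t : 1 < t -> der step t = 0.
  by apply: (@der_cst_gt _ 1) => s s0; rewrite step_ge1// ltW.
exists (M1 + M2) => [|t]; first exact: addr_ge0.
have [t01|/negP t01] := boolP (0 <= t <= 1).
  have [a b] := (H1 _ t01, H2 _ t01).
  case/andP: t01 => t0 t1.
  have nt : `|t| <= 1 by rewrite ger0_norm.
  have nt2 : `|t ^+ 2| <= 1 by rewrite normrX exprn_ile1.
  rewrite (normrM t) (normrM (t ^+ 2)); split.
  - by rewrite (le_trans (ler_piMl _ nt))//; lra.
  - by rewrite (le_trans (ler_piMl _ nt2))//; lra.
have [-> ->] : der step t = 0 /\ der (der step) t = 0.
  have [t0|t0] := ltP t 0.
    by split; [exact: z1|exact: der_cst_lt z1 _ t0].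
  have t1 : 1 < t by rewrite ltNge; apply/negP => t1; apply: t01; rewrite t0.
  by split; [exact: z2|exact: der_cst_gt z2 _ t1].
by rewrite !mulr0 normr0 addr_ge0.
Qed.

End Step.

(** * The entire function sin(sqrt t) / sqrt t *)

Section EntireSeries.
Variable R : realType.
Implicit Types (c : R^nat) (x t : R).

(** A condition stable under termwise differentiation and forcing the power
    series to converge on the whole line. *)
Definition entire c := exists A M : R,
  [/\ 0 <= A, 0 <= M & forall n, `|c n| <= A * M ^+ n / n`!%:R].

Lemma entire_cvg c x : entire c -> cvgn (pseries c x).
Proof.
move=> [A [M [A0 M0 cAM]]]; apply: normed_cvg.
apply: (@series_le_cvg _ _ (A *: exp_coeff (M * `|x|))).
- by move=> n; exact: normr_ge0.
- by move=> n; rewrite /GRing.scale/= mulr_ge0// exp_coeff_ge0// mulr_ge0.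
- move=> n; rewrite [leLHS]normrM normrX.
  rewrite [leRHS](_ : _ = A * M ^+ n / n`!%:R * `|x| ^+ n); last first.
    by rewrite -[LHS]/(A * ((M * `|x|) ^+ n / n`!%:R)) exprMn; ring.
  by apply: ler_wpM2r => //; exact: exprn_ge0.
- exact/is_cvg_seriesZ/is_cvg_series_exp_coeff.
Qed.

Lemma entire_diffs c : entire c -> entire (pseries_diffs c).
Proof.
move=> [A [M [A0 M0 cAM]]]; exists (A * M), M; split => // [|n].
  exact: mulr_ge0.
rewrite /pseries_diffs normrM normr_nat.
rewrite (le_trans (ler_wpM2l (ler0n _ _) (cAM n.+1)))//.
rewrite factS natrM invfM exprS.
rewrite [leLHS](_ : _ = n.+1%:R * n.+1%:R^-1 * (A * M * M ^+ n / n`!%:R)); last by ring.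
by rewrite divff ?mul1r// pnatr_eq0.
Qed.

Lemma Cinf_entire c : entire c -> Cinf (fun x => limn (pseries c x)).
Proof.
move=> ec; apply: (@Cinf_coind _
  (fun f => exists2 c, entire c & f = fun x => limn (pseries c x))); last by exists c.
move=> _ [{}c {}ec ->]; exists (fun x => limn (pseries (pseries_diffs c) x)).
  move=> x; apply: (@pseries_snd_diffs _ _ (`|x| + 1)).
  - exact: entire_cvg.
  - exact/entire_cvg/entire_diffs.
  - exact/entire_cvg/entire_diffs/entire_diffs.
  - by rewrite [ltRHS]ger0_norm ?ltrDl// addr_ge0.
by exists (pseries_diffs c) => //; exact: entire_diffs.
Qed.

(** S(t) is the sum of (- t)^n / (2 n + 1)!, so that S(s^2) = sin(s) / s. *)
Lemma exists_sinc : exists2 S : R -> R, Cinf S & forall s, s * S (s ^+ 2) = sin s.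
Proof.
pose c n : R := (-1) ^+ n / n.*2.+1`!%:R.
have ec : entire c.
  exists 1, 1; split => // n; rewrite expr1n mul1r normrM normrX normrN1 expr1n.
  rewrite mul1r normfV normr_nat div1r lef_pV2 ?posrE ?ltr0n ?fact_gt0//.
  have nn : (n.+1 <= n.*2.+1)%N by rewrite ltnS -addnn leq_addl.
  rewrite ler_nat -(ffact_fact nn) subSS -addnn addnK leq_pmull// ffact_gt0.
  by rewrite addnn.
exists (fun x => limn (pseries c x)) => [|s]; first exact: Cinf_entire.
have := @cvg_sin_coeff' R s => /cvg_lim <- //.
rewrite -[LHS]/(s *: _) -lim_seriesZ; last exact: entire_cvg.
congr (limn (series _)); apply/funext => n.
rewrite -[LHS]/(s * (c n * (s ^+ 2) ^+ n)) /c /sin_coeff'.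
rewrite (_ : s ^+ n.*2.+1 = s * (s ^+ 2) ^+ n); last first.
  by rewrite exprS -exprM mul2n.
by rewrite -exprnP; ring.
Qed.

End EntireSeries.

Section Sinc.
Variable R : realType.
Variable S : R -> R.
Hypothesis CS : Cinf S.
Hypothesis S_sin : forall s, s * S (s ^+ 2) = sin s.

Let CS1 := Cinf_der CS.
Let CS2 := Cinf_der CS1.

Lemma sinc_cos s : S (s ^+ 2) + 2 * s ^+ 2 * der S (s ^+ 2) = cos s.
Proof.
have d1 := is_derive1_chain (is_derive1_sqr s) (Cinf_is_derive CS (s ^+ 2)).
have d2 := is_derive1_mul (is_derive_id s (1 : R)) d1.
have d3 := is_derive_sin s.
rewrite (_ : sin = (fun y => y * S (y ^+ 2))) in d3; last first.
  by apply/funext => y; rewrite S_sin.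
rewrite -(is_derive1_unique d2 d3); ring.
Qed.

(** The derivative of sinc_cos in s, divided by s. *)
Lemma sinc_ode t : 0 < t ->
  4 * t * der (der S) t + 6 * der S t + S t = 0.
Proof.
move=> t0; pose s := Num.sqrt t.
have st : s ^+ 2 = t by rewrite sqr_sqrtr// ltW.
have s0 : s != 0 by rewrite gt_eqF// sqrtr_gt0.
rewrite -st.
have d1 := is_derive1_chain (is_derive1_sqr s) (Cinf_is_derive CS (s ^+ 2)).
have d2 := is_derive1_chain (is_derive1_sqr s) (Cinf_is_derive CS1 (s ^+ 2)).
have d3 := is_derive1_add d1 (is_derive1_mul (is_derive1_scale 2 (is_derive1_sqr s)) d2).
have d4 := is_derive_cos s.
rewrite (_ : cos = (fun y => S (y ^+ 2) + 2 * y ^+ 2 * der S (y ^+ 2))) in d4; last first.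
  by apply/funext => y; rewrite sinc_cos.
have := is_derive1_unique d3 d4; rewrite -S_sin => H.
by apply: (mulfI s0); rewrite mulr0; lra.
Qed.

Lemma sinc_ode' t : 0 < t ->
  4 * t * der (der (der S)) t + 10 * der (der S) t
    + der S t = 0.
Proof.
move=> t0.
have d0 := Cinf_is_derive CS t; have d1 := Cinf_is_derive CS1 t.
have d2 := Cinf_is_derive CS2 t.
have d4t := is_derive1_scale 4 (is_derive_id t (1 : R)).
have dW := is_derive1_add
  (is_derive1_add (is_derive1_mul d4t d2) (is_derive1_scale 6 d1)) d0.
have := der_cst_gt sinc_ode t0; rewrite derE (derive_val (is_derive := dW)).
by move=> H; rewrite -[RHS]H; ring.
Qed.

(** The matching condition. At pi^2 one has S = 0 and S' < 0; at (3 pi / 2)^2,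
    where the cosine vanishes and the sine is - 1, one has S < 0 < S'. So the
    left-hand side changes sign. At a zero, S' = 0 would force S = 0, and then
    the sine and the cosine of sqrt lambda would both be 0. *)
Lemma exists_frequency c : 0 < c < 1 -> exists2 lam, 0 < lam &
  (1 - c) * S lam - 6 * c * der S lam = 0 /\ der S lam != 0.
Proof.
move=> /andP[c0 c1].
pose V x := (1 - c) * S x - 6 * c * der S x.
have p0 : 0 < pi :> R by exact: pi_gt0.
have Vc : {within `[pi ^+ 2, (pi + pi / 2) ^+ 2], continuous V}.
  apply: continuous_subspaceT; apply: Cinf_continuous.
  by apply: CinfB; apply: CinfZ.
have sp : S (pi ^+ 2) = 0.
  by apply: (mulfI (lt0r_neq0 p0)); rewrite S_sin sinpi mulr0.
have V1 : 0 <= V (pi ^+ 2).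
  have := sinc_cos pi; rewrite cospi /V sp mulr0 add0r sub0r => H.
  have {}H : 2 * pi ^+ 2 * (- der S (pi ^+ 2)) = 1 by lra.
  have : 0 < - der S (pi ^+ 2).
    by rewrite -(@pmulr_rgt0 _ (2 * pi ^+ 2)) ?H// mulr_gt0// exprn_gt0.
  by move=> H2; rewrite -mulrN mulr_ge0//; lra.
have V2 : V ((pi + pi / 2) ^+ 2) <= 0.
  have q0 : 0 < pi + pi / 2 :> R by lra.
  have := S_sin (pi + pi / 2); have := sinc_cos (pi + pi / 2).
  rewrite sinD cosD cospi sinpi sin_pihalf cos_pihalf.
  rewrite !(mulr0, mul0r, subr0, add0r, mulr1).
  set q := pi + pi / 2 in q0 *; set a := S _; set b := der S _ => H1 H2.
  have a0 : a < 0 by rewrite -(pmulr_rlt0 _ q0) H2; lra.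
  have b0 : 0 < b.
    rewrite -(@pmulr_rgt0 _ (2 * q ^+ 2)); first lra.
    by rewrite mulr_gt0// exprn_gt0.
  rewrite /V -/a -/b; have := mulr_gt0 c0 b0; have : (1 - c) * a < 0.
    by rewrite pmulr_rlt0//; lra.
  lra.
have pp : pi ^+ 2 <= (pi + pi / 2) ^+ 2 :> R.
  by rewrite ler_sqr ?nnegrE; lra.
have [lam] := @IVT _ V _ _ 0 pp Vc (ltac:(rewrite ge_min V2 orbT le_max V1//)).
rewrite in_itv/= => /andP[l0 _] Vl.
have lam0 : 0 < lam by rewrite (lt_le_trans _ l0)// exprn_gt0.
exists lam => //; split => //; apply/eqP => S'0.
move: Vl; rewrite /V S'0 mulr0 subr0 => /eqP; rewrite mulf_eq0.
move=> /orP[|/eqP S0]; first by apply/negP; lra.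
have st : (Num.sqrt lam) ^+ 2 = lam by rewrite sqr_sqrtr// ltW.
have := S_sin (Num.sqrt lam); have := sinc_cos (Num.sqrt lam).
rewrite st S0 S'0 !mulr0 addr0 => H1 H2.
have := cos2Dsin2 (Num.sqrt lam); rewrite -H1 -H2.
by rewrite !expr0n/= addr0 => /eqP; rewrite eq_sym oner_eq0.
Qed.

End Sinc.

(** * The radial profile of the mode *)

Section Profile.
Variable R : realType.
Implicit Types (f g : R -> R) (a b x q t : R).

(** The exterior profile is a power of q, singular at 0, but only its values for
    q >= 1 matter. Composing the power with a smooth positive function that is
    the identity on q > 3 / 4 makes it smooth on the whole line. *)
Lemma powR_extension a : exists2 p, Cinf p & forall q, 3 / 4 < q ->
  [/\ p q = q `^ a, der p q = a * q `^ (a - 1) &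
      der (der p) q = a * ((a - 1) * q `^ (a - 1 - 1))].
Proof.
(* kap = 1 + (q - 1) theta, where theta = 0 for q <= 1 / 2 and theta = 1 for
   q >= 3 / 4. *)
pose kap q := 1 + step (4 * q + -2) * (1 * q + -1).
have Caff b c : Cinf (fun q => b * q + c).
  by apply: CinfD; [apply: CinfZ; exact: Cinf_id|exact: Cinf_cst].
have Ckap : Cinf kap.
  apply: CinfD; first exact: Cinf_cst.
  by apply: CinfM => //; apply: Cinf_comp => //; exact: Cinf_step.
have kap0 q : 0 < kap q.
  rewrite /kap; have [q2|q2] := leP q (1 / 2).
    by rewrite step_le0 ?mul0r; lra.
  have := step_ge0 (4 * q + -2); have := step_le1 (4 * q + -2).
  by set s := step _; nra.
have kapE q : 3 / 4 < q -> kap q = q.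
  by move=> q34; rewrite /kap step_ge1; lra.
exists (fun q => kap q `^ a); first exact: Cinf_powR.
have D1 q : 3 / 4 < q -> der (fun q => kap q `^ a) q = a * q `^ (a - 1).
  move=> q34; rewrite (@der_eq_gt _ _ (fun q => q `^ a) q (3 / 4))//.
    have q0 : 0 < q by lra.
    by rewrite derE; exact: (derive_val (is_derive := is_derive1_powR a q0)).
  by move=> t t34; rewrite kapE.
move=> q q34; split; [by rewrite kapE|exact: D1|].
rewrite (@der_eq_gt _ _ (fun q => a * q `^ (a - 1)) q (3 / 4))//.
have q0 : 0 < q by lra.
have := is_derive1_scale a (is_derive1_powR (a - 1) q0).
by move=> d; rewrite derE; exact: (derive_val (is_derive := d)).
Qed.

(** The interior profile g(q) = - 6 S'(lambda q) and the exterior profile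
    e(q) = b (q^(-3/2) - r^(-3)). The factor b is chosen for g and e to agree at
    1, and exists_frequency is then the equality of their derivatives there. *)
Lemma exists_profile r : 1 < r -> exists (lam : R) (g e : R -> R),
  [/\ 0 < lam, Cinf g /\ Cinf e,
      forall q : R, 0 < q ->
        4 * q * der (der g) q + 10 * der g q = - lam * g q,
      forall q : R, 1 <= q -> 4 * q * der (der e) q + 10 * der e q = 0
    & [/\ g 1 = e 1, der g 1 = der e 1, e (r ^+ 2) = 0,
          forall q, 1 <= q < r ^+ 2 -> e q != 0
        & forall q, 1 <= q -> der e q != 0]].
Proof.
move=> r1; pose a : R := - (3 / 2); pose c := (r ^+ 2) `^ a.
have r2 : 1 < r ^+ 2 by rewrite expr_gt1//; lra.
have inj q : 1 <= q < r ^+ 2 -> q `^ a != c.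
  move=> /andP[q1 qr]; apply/eqP; rewrite /c /a !powRN => /invr_inj.
  move=> /(@powR_injective _ (3 / 2) (ltac:(lra))); rewrite !nnegrE => H.
  suff : q = r ^+ 2 by lra.
  by apply: H; lra.
have c0 : 0 < c by rewrite powR_gt0; lra.
have c1 : c < 1.
  rewrite /c /a powRN invf_lt1 ?powR_gt0; [|lra|lra].
  have := @gt0_ltr_powR _ (3 / 2) (ltac:(lra)) 1 (r ^+ 2).
  by rewrite powR1; apply; rewrite ?nnegrE; lra.
have [S CS S_sin] := exists_sinc R.
have CS1 := Cinf_der CS; have CS2 := Cinf_der CS1.
have [lam lam0 [lamE S'0]] := exists_frequency CS S_sin (introT andP (conj c0 c1)).
have ode := sinc_ode CS S_sin; have ode' := sinc_ode' CS S_sin.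
have [p Cp pE] := powR_extension a.
have dlin (f : R -> R) : Cinf f -> forall k q,
    der (fun x => k * f (lam * x)) q = k * lam * der f (lam * q).
  move=> Cf k q; have dl := is_derive1_scale lam (is_derive_id q (1 : R)).
  have d := is_derive1_scale k (is_derive1_chain dl (Cinf_is_derive Cf (lam * q))).
  by rewrite derE (derive_val (is_derive := d)); ring.
pose g q := -6 * der S (lam * q).
have g1E q : der g q = -6 * lam * der (der S) (lam * q).
  by rewrite dlin.
have g2E q : der (der g) q =
    -6 * lam * lam * der (der (der S)) (lam * q).
  by rewrite (funext g1E) dlin.
pose b := g 1 / (1 - c).
pose e q := b * (p q - c).
have dp q := is_derive1_add (Cinf_is_derive Cp q) (is_derive1_cst (- c) q).
have e1E q : der e q = b * der p q.
  by rewrite derE (derive_val (is_derive := is_derive1_scale b (dp q))); ring.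
have e2E q : der (der e) q = b * der (der p) q.
  have d := is_derive1_scale b (Cinf_is_derive (Cinf_der Cp) q).
  by rewrite (funext e1E) derE (derive_val (is_derive := d)).
have b0 : b != 0.
  by rewrite /b /g mulr1 mulf_neq0 ?invr_eq0//; [rewrite mulf_neq0//; lra|lra].
have q34 q : 1 <= q -> 3 / 4 < q by lra.
have p1 : p 1 = 1 by have [-> _ _] := pE 1 (q34 _ (lexx _)); rewrite powR1.
have p'1 : der p 1 = a.
  by have [_ -> _] := pE 1 (q34 _ (lexx _)); rewrite powR1 mulr1.
exists lam, g, e; split => //.
- split; first by apply/CinfZ/Cinf_comp => //; apply: CinfZ; exact: Cinf_id.
  by apply/CinfZ/CinfB => //; exact: Cinf_cst.
- move=> q q0; rewrite g1E g2E /g; have := ode' _ (mulr_gt0 lam0 q0).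
  set u := der S _; set v := der (der S) _.
  set w := der (der (der S)) _.
  move=> H; transitivity (-6 * lam * (4 * (lam * q) * w + 10 * v)); first ring.
  transitivity (-6 * lam * (4 * (lam * q) * w + 10 * v + u) + 6 * lam * u); first ring.
  by rewrite H; ring.
- move=> q q1; rewrite e1E e2E; have [_ -> ->] := pE q (q34 _ q1).
  have q0 : 0 < q by lra.
  have -> : q `^ (a - 1) = q * q `^ (a - 1 - 1).
    rewrite -{2}(@powRr1 _ q) ?ltW// -powRD; last by apply/implyP => _; rewrite gt_eqF.
    by congr (_ `^ _); ring.
  by rewrite /a; field.
split.
- by rewrite /e p1 /b divfK//; lra.
- rewrite g1E e1E p'1 /b /g !mulr1 /a; have := ode _ lam0.
  move: lamE; set s := S lam; set s1 := der S lam; set s2 := der (der S) lam.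
  move=> H1 H2; have c1n : 1 - c != 0 by lra.
  apply: (mulIf c1n).
  transitivity (-6 * (lam * s2) * (1 - c)); first by ring.
  rewrite (_ : lam * s2 = - (6 * s1 + s) / 4); last by lra.
  (* the combination that vanishes by the choice of the frequency *)
  transitivity (3 / 2 * ((1 - c) * s - 6 * c * s1) + 9 * s1); first by field.
  by rewrite H1; field.
- rewrite /e; have [-> _ _] := pE (r ^+ 2) (q34 _ (ltW r2)).
  by rewrite -/c subrr mulr0.
- move=> q /[dup] qq /andP[q1 _]; rewrite /e; have [-> _ _] := pE q (q34 _ q1).
  by rewrite mulf_neq0// subr_eq0 inj.
- move=> q q1; rewrite e1E; have [_ -> _] := pE q (q34 _ q1).
  by rewrite mulf_neq0// mulf_neq0//; [rewrite /a; lra|rewrite gt_eqF// powR_gt0; lra].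
Qed.

End Profile.

(** * Smooth approximations of a profile with a jump in its second derivative *)

Section Cutoff.
Variable R : realType.
Implicit Types (f g e : R -> R) (a b x q t m B : R).

Lemma der_unique f f' : (forall x, is_derive x (1 : R) f (f' x)) -> der f = f'.
Proof.
by move=> df; apply/funext => x; rewrite derE (derive_val (is_derive := df x)).
Qed.

Lemma derM f g : Cinf f -> Cinf g ->
  der (fun x => f x * g x) = (fun x => f x * der g x + g x * der f x).
Proof.
by move=> Cf Cg; apply: der_unique => x; apply: is_derive1_mul; exact: Cinf_is_derive.
Qed.

Lemma derD f g : Cinf f -> Cinf g ->
  der (fun x => f x + g x) = (fun x => der f x + der g x).
Proof.
by move=> Cf Cg; apply: der_unique => x; apply: is_derive1_add; exact: Cinf_is_derive.
Qed.

Lemma derB f g : Cinf f -> Cinf g ->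
  der (fun x => f x - g x) = (fun x => der f x - der g x).
Proof.
move=> Cf Cg; apply: der_unique => x.
have df := Cinf_is_derive Cf x; have dg := Cinf_is_derive Cg x.
exact: is_deriveB.
Qed.

(** For m > 0, equal to 1 for q <= B - 1 / m and to 0 for q >= B. *)
Definition cutoff m B q : R := step (m * (B - q)).

Lemma is_derive1_reflect m B q : is_derive q (1 : R) (fun x => m * (B - x)) (- m).
Proof.
have d := is_derive1_mul (is_derive1_cst m q) (is_derive1_add
  (is_derive1_cst B q) (is_derive1_scale (-1) (is_derive_id q (1 : R)))).
rewrite (_ : (fun _ => _) = (fun y => m * (B + -1 * y))); last first.
  by apply/funext => y; rewrite mulN1r.
by apply: is_derive1_eq d _; ring.
Qed.

Lemma Cinf_cutoff m B : Cinf (cutoff m B).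
Proof.
apply: Cinf_comp; first exact: Cinf_step.
by apply: CinfZ; apply: CinfB; [exact: Cinf_cst|exact: Cinf_id].
Qed.

Lemma der_cutoff m B : der (cutoff m B) = fun q => - m * der (@step R) (m * (B - q)).
Proof.
apply: der_unique => q.
have d := is_derive1_chain (is_derive1_reflect m B q) (Cinf_is_derive (@Cinf_step R) _).
by apply: is_derive1_eq d _; ring.
Qed.

Lemma der2_cutoff m B : der (der (cutoff m B)) =
  fun q => m ^+ 2 * der (der (@step R)) (m * (B - q)).
Proof.
rewrite (der_cutoff m B); apply: der_unique => q.
have d := is_derive1_scale (- m)
  (is_derive1_chain (is_derive1_reflect m B q)
    (Cinf_is_derive (Cinf_der (@Cinf_step R)) _)).
by apply: is_derive1_eq d _; ring.
Qed.

Lemma cutoff_out m B q : 0 <= m -> B <= q -> cutoff m B q = 0.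
Proof.
by move=> m0 Bq; rewrite /cutoff step_le0// mulr_ge0_le0// subr_le0.
Qed.

Lemma der_cutoff_out m B q : 0 < m -> B < q ->
  der (cutoff m B) q = 0 /\ der (der (cutoff m B)) q = 0.
Proof.
move=> m0 Bq.
have z1 t : B < t -> der (cutoff m B) t = 0.
  by apply: (@der_cst_gt _ _ 0) => s sB; rewrite cutoff_out ?ltW.
by split; [exact: z1|exact: (der_cst_gt z1)].
Qed.

Lemma cutoff_in m B q : 1 < m * (B - q) ->
  [/\ cutoff m B q = 1, der (cutoff m B) q = 0 & der (der (cutoff m B)) q = 0].
Proof.
move=> mq; have z1 t : 1 < t -> der (@step R) t = 0.
  by apply: (@der_cst_gt _ _ 1) => s s1; rewrite step_ge1 ?ltW.
split; first by rewrite /cutoff step_ge1// ltW.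
  by rewrite der_cutoff z1// mulr0.
by rewrite der2_cutoff (der_cst_gt z1)// mulr0.
Qed.

Lemma cutoff_bounded m B q : `|cutoff m B q| <= 1.
Proof. by rewrite ger0_norm ?step_ge0// step_le1. Qed.

(** The bound does not depend on the steepness m: this is why a function that
    vanishes at B to first (second) order can be cut off near B with control of
    its first (two) derivatives. *)
Lemma der_cutoff_bounded : exists2 K, 0 <= K & forall m B q,
  `|(B - q) * der (cutoff m B) q| <= K /\
  `|(B - q) ^+ 2 * der (der (cutoff m B)) q| <= K.
Proof.
have [K K0 H] := der_step_bounded R; exists K => // m B q.
have [h1 h2] := H (m * (B - q)); rewrite (der2_cutoff m B) (der_cutoff m B); split.
  rewrite (_ : (B - q) * (- m * _) = - (m * (B - q) * der (@step R) (m * (B - q)))) ?normrN//.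
  by ring.
rewrite (_ : (B - q) ^+ 2 * (m ^+ 2 * _) =
  (m * (B - q)) ^+ 2 * der (der (@step R)) (m * (B - q)))//.
by ring.
Qed.

Lemma lipschitz_segment f B : Cinf f -> 0 <= B -> exists2 K, 0 <= K &
  forall x y, 0 <= x <= B -> 0 <= y <= B -> `|f x - f y| <= K * `|x - y|.
Proof.
move=> Cf B0.
have [K K0 H] := bounded_on_segment 0 B (Cinf_continuous (Cinf_der Cf)).
exists K => //.
suff W x y : x <= y -> 0 <= x <= B -> 0 <= y <= B -> `|f y - f x| <= K * `|y - x|.
  move=> x y xB yB; have [xy|/ltW yx] := leP x y; last exact: W.
  by rewrite distrC (distrC x); exact: W.
move=> xy /andP[x0 _] /andP[_ yB].
have [c cxy ->] := MVT_segment xy (fun z _ => Cinf_is_derive Cf z)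
  (continuous_subspaceT (Cinf_continuous Cf)).
rewrite normrM ler_wpM2r// H//.
by move: cxy; rewrite in_itv/= => /andP[xc cy]; lra.
Qed.

(** The value at 1 is the exterior one: for second derivatives, the only ones to
    jump, this makes the set where the equation reads - lambda h the open unit
    ball. *)
Definition piecewise g e q : R := if q < 1 then g q else e q.

(** The interior piece up to 1 - 1 / (n + 1) and the exterior one from 1 on. *)
Definition blend g e n q : R := e q + (g q - e q) * cutoff n.+1%:R 1 q.

Section Glue.
Variables (g e : R -> R).
Hypotheses (Cg : Cinf g) (Ce : Cinf e).
Hypotheses (ge1 : g 1 = e 1) (ge1' : der g 1 = der e 1).

Let d q := g q - e q.
Let Cd : Cinf d. Proof. exact: CinfB. Qed.
Let d1 : d 1 = 0. Proof. by rewrite /d ge1 subrr. Qed.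

Let der_d : der d = fun q => der g q - der e q.
Proof. exact: derB. Qed.

Let der2_d : der (der d) = fun q => der (der g) q - der (der e) q.
Proof. by rewrite der_d derB//; exact: Cinf_der. Qed.

Let d1' : der d 1 = 0. Proof. by rewrite der_d ge1' subrr. Qed.

Lemma Cinf_blend n : Cinf (blend g e n).
Proof. by apply: CinfD => //; apply: CinfM => //; exact: Cinf_cutoff. Qed.

Lemma der_blend n : der (blend g e n) = fun q =>
  der e q + (d q * der (cutoff n.+1%:R 1) q + cutoff n.+1%:R 1 q * der d q).
Proof.
rewrite derD//; last by apply: CinfM => //; exact: Cinf_cutoff.
by rewrite (derM Cd (Cinf_cutoff _ _)).
Qed.

Lemma der2_blend n : der (der (blend g e n)) = fun q =>
  der (der e) q +
  ((d q * der (der (cutoff n.+1%:R 1)) q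
    + der (cutoff n.+1%:R 1) q * der d q) +
   (cutoff n.+1%:R 1 q * der (der d) q
    + der d q * der (cutoff n.+1%:R 1) q)).
Proof.
have Cc := Cinf_cutoff n.+1%:R 1; have Cc' := Cinf_der Cc.
have Cd' := Cinf_der Cd; have Ce' := Cinf_der Ce.
rewrite der_blend derD//; last by apply: CinfD; apply: CinfM.
by rewrite (derD (CinfM Cd Cc') (CinfM Cc Cd')) (derM Cd Cc') (derM Cc Cd').
Qed.

(** At q = 1 itself the derivatives of the cutoff are multiplied by g - e and its
    derivative, which vanish there. *)
Lemma blend_out n q : 1 <= q -> [/\ blend g e n q = e q,
  der (blend g e n) q = der e q &
  der (der (blend g e n)) q = der (der e) q].
Proof.
move=> q1; rewrite der2_blend der_blend /blend cutoff_out//.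
have [->|qn1] := eqVneq q 1.
  by rewrite d1 d1' !(mul0r, mulr0, addr0).
have ql1 : 1 < q by rewrite lt_neqAle eq_sym qn1.
have [-> ->] := @der_cutoff_out n.+1%:R 1 q (ltr0Sn _ _) ql1.
by rewrite !(mul0r, mulr0, addr0).
Qed.

Lemma blend_in n q : 1 < n.+1%:R * (1 - q) -> [/\ blend g e n q = g q,
  der (blend g e n) q = der g q &
  der (der (blend g e n)) q = der (der g) q].
Proof.
move=> nq; have [c0 c1 c2] := cutoff_in nq.
rewrite der2_blend der_blend /blend c0 c1 c2 der2_d der_d.
by rewrite !(mul0r, mulr0, addr0, add0r, mul1r, mulr1) ![_ + (_ - _)]addrC !subrK.
Qed.

Lemma near_mul_gt1 c : 0 < c -> \forall n \near \oo, 1 < n.+1%:R * c :> R.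
Proof.
move=> c0; near=> n; rewrite -ltr_pdivrMr// div1r.
rewrite (@lt_le_trans _ _ n%:R)//; last by rewrite ler_nat.
by near: n; exact: nbhs_infty_gtr.
Unshelve. all: by end_near. Qed.

Lemma blend_near q : \forall n \near \oo, [/\ blend g e n q = piecewise g e q,
  der (blend g e n) q = piecewise (der g) (der e) q &
  der (der (blend g e n)) q =
    piecewise (der (der g)) (der (der e)) q].
Proof.
rewrite /piecewise; have [q1|q1] := ltP q 1; last first.
  by near=> n; exact: blend_out.
have c0 : 0 < 1 - q by rewrite subr_gt0.
have := near_mul_gt1 c0; apply: filterS => n; exact: blend_in.
Unshelve. all: by end_near. Qed.

(** Since d = g - e and d' vanish at 1, d is O((1 - q)^2) and d' is O(1 - q).
    These factors absorb the derivatives of the cutoff. *)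
Lemma blend_bounded B : 1 <= B -> exists2 K, 0 <= K & forall n q, 0 <= q <= B ->
  [/\ `|blend g e n q| <= K, `|der (blend g e n) q| <= K &
      `|der (der (blend g e n)) q| <= K].
Proof.
move=> B1; have B0 : 0 <= B by lra.
have Cd' := Cinf_der Cd; have Ce' := Cinf_der Ce.
have bs f : Cinf f -> exists2 M, 0 <= M & forall t, 0 <= t <= B -> `|f t| <= M.
  by move=> Cf; apply: bounded_on_segment; exact: Cinf_continuous.
have [Me Me0 He] := bs _ Ce; have [Me1 Me10 He1] := bs _ Ce'.
have [Me2 Me20 He2] := bs _ (Cinf_der Ce').
have [Md Md0 Hd] := bs _ Cd; have [Md1 Md10 Hd1] := bs _ Cd'.
have [L L0 HL] := lipschitz_segment Cd' B0.
have [Md2 Md20 Hd2] := bs _ (Cinf_der Cd').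
have [K K0 HK] := der_cutoff_bounded.
have one : 0 <= (1 : R) <= B by rewrite ler01.
(* First-order vanishing of d', then second-order vanishing of d. *)
have dL q : 0 <= q <= B -> `|der d q| <= L * `|1 - q|.
  by move=> qB; have := HL _ _ qB one; rewrite d1' subr0 distrC.
have dLL q : 0 <= q <= B -> `|d q| <= L * `|1 - q| ^+ 2.
  move=> qB.
  have W x y : x <= y -> 0 <= x <= B -> 0 <= y <= B -> x <= 1 <= y ->
      `|d y - d x| <= L * `|y - x| * `|y - x|.
    move=> xy xB yB x1y.
    have [c cxy ->] := MVT_segment xy (fun z _ => Cinf_is_derive Cd z)
      (continuous_subspaceT (Cinf_continuous Cd)).
    rewrite normrM ler_wpM2r//; move: cxy; rewrite in_itv/= => /andP[xc cy].
    rewrite (le_trans (dL c _))//; first lra.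
    rewrite ler_wpM2l// (ger0_norm (_ : 0 <= y - x)); last lra.
    rewrite ler_norml; lra.
  have [q1|/ltW q1] := leP q 1.
    by have := W q 1 q1 qB one; rewrite d1 sub0r normrN expr2 mulrA; apply; lra.
  by have := W 1 q q1 one qB; rewrite d1 subr0 expr2 mulrA (distrC q 1); apply; lra.
exists (Me + Md + (Me1 + L * B * K + L * K + Md1) + (Me2 + L * K + Md2 + L * K + L * K)).
  by rewrite !addr_ge0 ?mulr_ge0.
move=> n q qB.
have [c1 c2] := HK n.+1%:R 1 q; have c0 := cutoff_bounded n.+1%:R 1 q.
have := He q qB; have := He1 q qB; have := He2 q qB.
have := Hd q qB; have := Hd1 q qB; have := Hd2 q qB.
have := dL q qB; have := dLL q qB.
rewrite der2_blend der_blend /blend -/(d q).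
move: c0 c1 c2; rewrite (normrM (1 - q)) (normrM ((1 - q) ^+ 2)) normrX.
set c := cutoff _ _ q; set c' := der (cutoff _ _) q.
set c'' := der (der (cutoff _ _)) q.
set D := d q; set D' := der d q; set D'' := der (der d) q.
set e0 := e q; set e1 := der e q; set e2 := der (der e) q.
move=> c0 c1 c2 DLL DL bD2 bD1 bD be2 be1 be0.
have q1B : `|1 - q| <= B by rewrite ler_norml; lra.
have p1 (x y z : R) : `|x| <= z -> `|y| <= 1 -> `|x * y| <= z.
  by move=> xz y1; rewrite normrM (le_trans _ xz)// ler_piMr.
have t1 := p1 _ _ _ bD c0.
have t2 : `|c * D'| <= Md1 by rewrite mulrC; exact: p1.
have t3 : `|c * D''| <= Md2 by rewrite mulrC; exact: p1.
have t4 : `|D' * c'| <= L * K.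
  rewrite normrM (le_trans (ler_wpM2r (normr_ge0 _) DL))// -mulrA.
  by rewrite ler_wpM2l.
have t5 : `|D * c''| <= L * K.
  rewrite normrM (le_trans (ler_wpM2r (normr_ge0 _) DLL))// -mulrA.
  by rewrite ler_wpM2l.
have t6 : `|D * c'| <= L * B * K.
  rewrite normrM (le_trans (ler_wpM2r (normr_ge0 _) DLL))// expr2 -2!mulrA -mulrA.
  by rewrite ler_wpM2l// ler_pM// mulr_ge0.
have t7 : `|c' * D'| <= L * K by rewrite mulrC.
have LK0 : 0 <= L * K by rewrite mulr_ge0.
have LBK0 : 0 <= L * B * K by rewrite !mulr_ge0.
split.
- rewrite (le_trans (ler_normD _ _))//; lra.
- rewrite (le_trans (ler_normD _ _))//.
  have := ler_normD (D * c') (c * D'); lra.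
- rewrite (le_trans (ler_normD _ _))//.
  have := ler_normD (D * c'' + c' * D') (c * D'' + D' * c').
  have := ler_normD (D * c'') (c' * D'); have := ler_normD (c * D'') (D' * c'); lra.
Qed.

End Glue.
End Cutoff.

Section Approximants.
Variable R : realType.
Variables (g e : R -> R) (B : R).
Hypotheses (Cg : Cinf g) (Ce : Cinf e) (B1 : 1 < B).
Hypotheses (ge1 : g 1 = e 1) (ge1' : der g 1 = der e 1).

(** The approximations used to integrate by parts on E: they vanish beyond
    q = B, together with their derivatives. Cutting off at B costs a factor
    1 / (B - q) in the derivative, compensated by the vanishing of the profile
    at B. *)
Lemma approx_trace : e B = 0 -> exists k : nat -> R -> R,
  [/\ forall n, Cinf (k n),
      forall n q, B <= q -> k n q = 0 /\ der (k n) q = 0,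
      exists2 K, 0 <= K & forall n q, 0 <= q <= B ->
        `|k n q| <= K /\ `|der (k n) q| <= K
    & forall q, q < B -> \forall n \near \oo, k n q = piecewise g e q /\
        der (k n) q = piecewise (der g) (der e) q].
Proof.
move=> eB0; pose k n q := blend g e n q * cutoff n.+1%:R B q.
have CG n : Cinf (blend g e n) by exact: Cinf_blend.
have k'E n : der (k n) = fun q => blend g e n q * der (cutoff n.+1%:R B) q +
    cutoff n.+1%:R B q * der (blend g e n) q.
  by rewrite (derM (CG n) (Cinf_cutoff _ _)).
have GB n : blend g e n B = 0.
  by have [-> _ _] := blend_out Cg Ce ge1 ge1' n (ltW B1).
exists k; split.
- by move=> n; apply: CinfM => //; exact: Cinf_cutoff.
- move=> n q Bq; rewrite k'E /k cutoff_out// mul0r mulr0 addr0; split => //.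
  have [->|qnB] := eqVneq q B; first by rewrite GB mul0r.
  have Bltq : B < q by rewrite lt_neqAle eq_sym qnB.
  by have [-> _] := @der_cutoff_out _ n.+1%:R B q (ltr0Sn _ _) Bltq; rewrite mulr0.
- have [K K0 HK] := blend_bounded Cg Ce ge1 ge1' (ltW B1).
  have [Kc Kc0 HKc] := der_cutoff_bounded R.
  exists (K + K * Kc) => [|n q /[dup] qB /andP[q0 qleB]].
    by rewrite addr_ge0// mulr_ge0.
  have [G0 G1 _] := HK n _ qB; have [c1 _] := HKc n.+1%:R B q.
  have c0 := cutoff_bounded n.+1%:R B q.
  have KKc : 0 <= K * Kc by exact: mulr_ge0.
  have p0 : `|k n q| <= K by rewrite normrM (le_trans _ G0)// ler_piMr.
  split; first by lra.
  rewrite k'E (le_trans (ler_normD _ _))// addrC lerD//.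
    by rewrite normrM (le_trans _ G1)// ler_piMl.
  have [c cxy] := MVT_segment qleB (fun z _ => Cinf_is_derive (CG n) z)
    (continuous_subspaceT (Cinf_continuous (CG n))).
  rewrite GB sub0r => /eqP; rewrite eqr_oppLR => /eqP ->.
  rewrite mulNr normrN -mulrA normrM ler_pM//.
  move: cxy; rewrite in_itv/= => /andP[qc cB].
  by have [] := HK n c (introT andP (conj (le_trans q0 qc) cB)).
- move=> q qB.
  have c0 : 0 < B - q by rewrite subr_gt0.
  have := near_mul_gt1 c0; have := blend_near Cg Ce ge1 ge1' q.
  apply: filterS2 => n [h1 h2 _] /cutoff_in[c1 c2 _].
  by rewrite k'E /k h1 h2 c1 c2 mulr1 mulr0 add0r mul1r.
Qed.

(** The approximations from which test fields are made: these must have compact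
    support but are unconstrained near the boundary of the ball, so that they
    are cut off beyond it and two derivatives can be controlled. *)
Lemma approx_test : exists h : nat -> R -> R,
  [/\ forall n, Cinf (h n),
      forall n q, B + 1 <= q -> h n q = 0,
      exists2 K, 0 <= K & forall n q, 0 <= q < B ->
        [/\ `|h n q| <= K, `|der (h n) q| <= K &
            `|der (der (h n)) q| <= K]
    & forall q, q < B -> \forall n \near \oo,
        [/\ h n q = piecewise g e q, der (h n) q = piecewise (der g) (der e) q &
            der (der (h n)) q =
              piecewise (der (der g)) (der (der e)) q]].
Proof.
pose h n q := blend g e n q * cutoff 1 (B + 1) q.
have CG n : Cinf (blend g e n) by exact: Cinf_blend.
have h0 n q : q < B -> h n q = blend g e n q.
  move=> qB; have q1 : 1 < 1 * (B + 1 - q) by lra.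
  by rewrite /h; have [-> _ _] := cutoff_in q1; rewrite mulr1.
have h1 n q : q < B -> der (h n) q = der (blend g e n) q.
  by move=> qB; apply: (@der_eq_lt _ _ _ _ B) => // t; exact: h0.
have h2 n q : q < B -> der (der (h n)) q = der (der (blend g e n)) q.
  by move=> qB; apply: (@der_eq_lt _ _ _ _ B) => // t; exact: h1.
exists h; split.
- by move=> n; apply: CinfM => //; exact: Cinf_cutoff.
- by move=> n q Bq; rewrite /h cutoff_out// mulr0.
- have [K K0 HK] := blend_bounded Cg Ce ge1 ge1' (ltW B1).
  exists K => // n q /andP[q0 qB]; rewrite h0// h1// h2//.
  by apply: HK; rewrite q0 ltW.
- move=> q qB; have := blend_near Cg Ce ge1 ge1' q.
  by apply: filterS => n; rewrite h0// h1// h2.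
Qed.

End Approximants.

(** * Curls of toroidal and poloidal fields *)

Section Space.
Variable R : realType.
Notation P := (R * R * R)%type.
Implicit Types (f g : P -> R) (h : R -> R) (x v : P) (i j : 'I_3).

Definition i0 : 'I_3 := @Ordinal 3 0 isT.
Definition i1 : 'I_3 := @Ordinal 3 1 isT.
Definition i2 : 'I_3 := @Ordinal 3 2 isT.

Lemma ord3_ind (Q : 'I_3 -> Prop) : Q i0 -> Q i1 -> Q i2 -> forall i, Q i.
Proof.
move=> q0 q1 q2 [[|[|[|//]]] ilt]; [move: q0|move: q1|move: q2];
  by congr (Q _); exact: val_inj.
Qed.

(** Directional derivatives are one-dimensional derivatives along lines, which
    makes the one-dimensional chain rule available. *)
Lemma is_derive_line f x v a :
  is_derive 0 (1 : R) (fun t : R => f (t *: v + x)) a -> is_derive x v f a.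
Proof.
move=> [df da]; apply: DeriveDef; first exact/(derivable1P f x v).2.
rewrite -da /derive.
congr (lim _); apply: (congr1 (fun F => F @ 0^')); apply/funext => t /=.
by rewrite addr0 scale0r add0r [t *: 1]mulr1.
Qed.

Lemma is_derive_to_line f x v a :
  is_derive x v f a -> is_derive 0 (1 : R) (fun t : R => f (t *: v + x)) a.
Proof.
move=> [df da]; apply: DeriveDef; first exact/(derivable1P f x v).1.
rewrite -da /derive; congr (lim _); apply: (congr1 (fun F => F @ 0^')); apply/funext => t /=.
by rewrite addr0 scale0r add0r [t *: 1]mulr1.
Qed.

Definition crd i x : R := if i == 0%N :> nat then x.1.1 else
  if i == 1%N :> nat then x.1.2 else x.2.

Definition normsq x : R := crd i0 x ^+ 2 + crd i1 x ^+ 2 + crd i2 x ^+ 2.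

Lemma is_derive_crd i j x : is_derive x (basis3 R j) (crd i) (i == j)%:R.
Proof.
apply: is_derive_line.
rewrite (_ : (fun _ => _) = (fun t => (i == j)%:R * t + crd i x)); last first.
  apply/funext => t; rewrite /crd /basis3.
  by elim/ord3_ind : i; elim/ord3_ind : j => /=;
     rewrite /GRing.scale/= ?(mulr1, mulr0, mul1r, mul0r).
exact: is_derive1_affine.
Qed.

Lemma is_derive_radial h x v a : Cinf h -> is_derive x v normsq a ->
  is_derive x v (fun y => h (normsq y)) (der h (normsq x) * a).
Proof.
move=> Ch /is_derive_to_line dq; apply: is_derive_line.
have := is_derive1_chain dq; rewrite scale0r add0r; apply.
exact: Cinf_is_derive.
Qed.

Lemma is_derive_fmul f g x v a b : is_derive x v f a -> is_derive x v g b ->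
  is_derive x v (fun y => f y * g y) (f x * b + g x * a).
Proof. by move=> df dg; exact: is_deriveM. Qed.

Lemma is_derive_fadd f g x v a b : is_derive x v f a -> is_derive x v g b ->
  is_derive x v (fun y => f y + g y) (a + b).
Proof. by move=> df dg; exact: is_deriveD. Qed.

Lemma is_derive_fcst c x v : is_derive x v (fun=> c : R) 0.
Proof. exact: is_derive_cst. Qed.

Lemma is_derive_normsq j x : is_derive x (basis3 R j) normsq (2 * crd j x).
Proof.
have d i := is_derive_fmul (is_derive_crd i j x) (is_derive_crd i j x).
have := is_derive_fadd (is_derive_fadd (d i0) (d i1)) (d i2) => D.
have E : 2 * crd j x = crd i0 x * (i0 == j)%:R + crd i0 x * (i0 == j)%:R
  + (crd i1 x * (i1 == j)%:R + crd i1 x * (i1 == j)%:R)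
  + (crd i2 x * (i2 == j)%:R + crd i2 x * (i2 == j)%:R).
  by elim/ord3_ind : j {d D} => /=; ring.
by rewrite E; exact: D.
Qed.

(** A class of functions that is stable under partial derivatives, hence made of
    smooth functions, and large enough to contain the components of the fields
    h(|x|^2) (e_3 x x) and of their curls. *)
Inductive elementary : (P -> R) -> Prop :=
| elementary_cst c : elementary (fun=> c)
| elementary_crd i : elementary (crd i)
| elementary_radial h : Cinf h -> elementary (fun x => h (normsq x))
| elementary_add f g : elementary f -> elementary g -> elementary (fun x => f x + g x)
| elementary_mul f g : elementary f -> elementary g -> elementary (fun x => f x * g x).

Lemma differentiable_crd i x : differentiable (crd i) x.
Proof.
have cf (U V : normedModType R) (z : U * V) : differentiable (fst : U * V -> U) z.
  apply: (@linear_differentiable R (U * V)%type U fst) => y; exact: cvg_fst.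
have cs (U V : normedModType R) (z : U * V) : differentiable (snd : U * V -> V) z.
  apply: (@linear_differentiable R (U * V)%type V snd) => y; exact: cvg_snd.
elim/ord3_ind : i; rewrite /crd/=.
- by apply: (@differentiable_comp _ _ _ _ fst fst).
- by apply: (@differentiable_comp _ _ _ _ fst snd).
- exact: cs.
Qed.

Lemma elementary_differentiable f : elementary f -> forall x, differentiable f x.
Proof.
have dq y : differentiable normsq y.
  have d i := differentiableM (@differentiable_crd i y) (@differentiable_crd i y).
  exact: (differentiableD (differentiableD (d i0) (d i1)) (d i2)).
elim=> {f} [c|i|h Ch|f g _ df _ dg|f g _ df _ dg] x.
- exact: differentiable_cst.
- exact: differentiable_crd.
- apply: (@differentiable_comp _ _ _ _ normsq h) => //.
  by apply/derivable1_diffP; have [] := Cinf_is_derive Ch (normsq x).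
- exact: differentiableD.
- exact: differentiableM.
Qed.

Lemma partial_unique i f f' : (forall x, is_derive x (basis3 R i) f (f' x)) ->
  partial i f = f'.
Proof. by move=> df; apply/funext => x; rewrite /partial derive_val. Qed.

Lemma is_derive_partial i f x : differentiable f x ->
  is_derive x (basis3 R i) f (partial i f x).
Proof. by move=> df; apply/derivableP/diff_derivable. Qed.

Lemma elementary_partial i f : elementary f -> elementary (partial i f).
Proof.
elim=> {f} [c|j|h Ch|f g ef df eg dg|f g ef df eg dg].
- rewrite (partial_unique (fun x => is_derive_fcst c x _)); exact: elementary_cst.
- rewrite (partial_unique (is_derive_crd j i)); exact: elementary_cst.
- rewrite (partial_unique (fun x => is_derive_radial Ch (is_derive_normsq i x))).
  apply: elementary_mul; first exact/elementary_radial/Cinf_der.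
  by apply: elementary_mul; [exact: elementary_cst|exact: elementary_crd].
- have D x := is_derive_fadd (is_derive_partial i (elementary_differentiable ef x))
    (is_derive_partial i (elementary_differentiable eg x)).
  by rewrite (partial_unique D); exact: elementary_add.
- have D x := is_derive_fmul (is_derive_partial i (elementary_differentiable ef x))
    (is_derive_partial i (elementary_differentiable eg x)).
  by rewrite (partial_unique D); apply: elementary_add; exact: elementary_mul.
Qed.

Lemma elementary_smooth f : elementary f -> smooth f.
Proof.
move=> ef s; suff : elementary (foldr (@partial R) f s) by exact: elementary_differentiable.
by elim: s => //= i s; exact: elementary_partial.
Qed.

Definition vec3 (a b c : R) : 'rV[R]_3 :=
  \row_(i < 3) (if i == 0%N :> nat then a else if i == 1%N :> nat then b else c).

Lemma vec3E a b c : [/\ vec3 a b c ord0 i0 = a, vec3 a b c ord0 i1 = b &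
  vec3 a b c ord0 i2 = c].
Proof. by split; rewrite mxE. Qed.

Lemma vec3P (u : 'rV[R]_3) a b c :
  u ord0 i0 = a -> u ord0 i1 = b -> u ord0 i2 = c -> u = vec3 a b c.
Proof.
move=> ua ub uc; apply/rowP => i; rewrite [in RHS]mxE.
by elim/ord3_ind : i.
Qed.

Lemma curl_vec3 (phi : P -> 'rV[R]_3) x :
  let c i y := phi y ord0 i in
  curl phi x = vec3 (partial i1 (c i2) x - partial i2 (c i1) x)
                    (partial i2 (c i0) x - partial i0 (c i2) x)
                    (partial i0 (c i1) x - partial i1 (c i0) x).
Proof.
have e01 : i0 + 1 = i1 by apply/val_inj.
have e12 : i1 + 1 = i2 by apply/val_inj.
have e20 : i2 + 1 = i0 by apply/val_inj.
by apply: vec3P; rewrite mxE ?(e01, e12, e20).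
Qed.

(** h(|x|^2) (e_3 x x). *)
Definition toroidal h x : 'rV[R]_3 :=
  vec3 (- (crd i1 x * h (normsq x))) (crd i0 x * h (normsq x)) 0.

(** 2 h e_3 + 2 h' (|x|^2 e_3 - x_3 x), the functions being taken at |x|^2. The
    derivative is a separate argument so that the limit field, whose profile is
    not smooth, can be written in the same way. *)
Definition poloidal h h' x : 'rV[R]_3 :=
  vec3 (- (2 * (crd i0 x * crd i2 x * h' (normsq x))))
       (- (2 * (crd i1 x * crd i2 x * h' (normsq x))))
       (2 * h (normsq x) + 2 * ((crd i0 x ^+ 2 + crd i1 x ^+ 2) * h' (normsq x))).

Lemma is_derive_fopp f x v a : is_derive x v f a -> is_derive x v (fun y => - f y) (- a).
Proof. by move=> df; exact: is_deriveN. Qed.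

Lemma curl_toroidal h : Cinf h -> curl (toroidal h) = poloidal h (der h).
Proof.
move=> Ch; apply/funext => x; rewrite curl_vec3.
have dh j y := is_derive_radial Ch (is_derive_normsq j y).
have cE y := vec3E (- (crd i1 y * h (normsq y))) (crd i0 y * h (normsq y)) 0.
have -> : (fun y => toroidal h y ord0 i0) = fun y => - (crd i1 y * h (normsq y)).
  by apply/funext => y; have [] := cE y.
have -> : (fun y => toroidal h y ord0 i1) = fun y => crd i0 y * h (normsq y).
  by apply/funext => y; have [] := cE y.
have -> : (fun y => toroidal h y ord0 i2) = fun y => 0.
  by apply/funext => y; have [] := cE y.
rewrite !(partial_unique (fun y => is_derive_fcst 0 y _)).
rewrite !(partial_unique (fun y => is_derive_fmul (is_derive_crd i0 _ y) (dh _ y))).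
rewrite !(partial_unique (fun y => is_derive_fopp (is_derive_fmul (is_derive_crd i1 _ y) (dh _ y)))).
by rewrite /poloidal /=; congr vec3; ring.
Qed.

Lemma curl_poloidal h : Cinf h -> curl (poloidal h (der h)) =
  toroidal (fun q => - (4 * q * der (der h) q + 10 * der h q)).
Proof.
move=> Ch; apply/funext => x; rewrite curl_vec3.
have Ch' := Cinf_der Ch.
have dh j y := is_derive_radial Ch (is_derive_normsq j y).
have dh' j y := is_derive_radial Ch' (is_derive_normsq j y).
have cE y := vec3E (- (2 * (crd i0 y * crd i2 y * der h (normsq y))))
       (- (2 * (crd i1 y * crd i2 y * der h (normsq y))))
       (2 * h (normsq y) + 2 * ((crd i0 y ^+ 2 + crd i1 y ^+ 2) * der h (normsq y))).
pose f0 y := - (2 * (crd i0 y * crd i2 y * der h (normsq y))).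
pose f1 y := - (2 * (crd i1 y * crd i2 y * der h (normsq y))).
pose f2 y := 2 * h (normsq y) +
  2 * ((crd i0 y * crd i0 y + crd i1 y * crd i1 y) * der h (normsq y)).
have -> : (fun y => poloidal h (der h) y ord0 i0) = f0.
  by apply/funext => y; have [] := cE y.
have -> : (fun y => poloidal h (der h) y ord0 i1) = f1.
  by apply/funext => y; have [] := cE y.
have -> : (fun y => poloidal h (der h) y ord0 i2) = f2.
  by apply/funext => y; have [] := cE y; rewrite /f2 -!expr2.
have d0 i j k y := is_derive_fopp (is_derive_fmul (is_derive_fcst 2 y _)
  (is_derive_fmul (is_derive_fmul (is_derive_crd i k y) (is_derive_crd j k y)) (dh' k y))).
have dsqr i k y := is_derive_fmul (is_derive_crd i k y) (is_derive_crd i k y).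
have d2 k y := is_derive_fadd
  (is_derive_fmul (is_derive_fcst 2 y _) (dh k y))
  (is_derive_fmul (is_derive_fcst 2 y _)
    (is_derive_fmul (is_derive_fadd (dsqr i0 k y) (dsqr i1 k y)) (dh' k y))).
rewrite /f0 /f1 /f2 !(partial_unique (d0 i0 i2 _)) !(partial_unique (d0 i1 i2 _)).
rewrite !(partial_unique (d2 _)) /toroidal /=.
have -> : normsq x = crd i0 x ^+ 2 + crd i1 x ^+ 2 + crd i2 x ^+ 2 by [].
set q := _ + crd i2 x ^+ 2.
by congr vec3; rewrite /q; ring.
Qed.

End Space.

(** * Integrals of partial derivatives *)

Section Measure.
Variable R : realType.
Notation P := (R * R * R)%type.
Notation MR := (measurableTypeR R).
Notation MP := (MR * MR * MR)%type.

(** An open set is the union of the boxes with rational centers and radii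
    1 / (n + 1) that it contains. *)
Lemma open_measurable_space (U : set P) : open U -> measurable (U : set MP).
Proof.
move=> oU.
pose box (a b c : R) (n : nat) : set MP :=
  (`]a - n.+1%:R^-1, a + n.+1%:R^-1[ `*` `]b - n.+1%:R^-1, b + n.+1%:R^-1[)
  `*` `]c - n.+1%:R^-1, c + n.+1%:R^-1[.
have -> : U = \bigcup_n \bigcup_(a in @setT rat) \bigcup_(b in @setT rat)
    \bigcup_(c in @setT rat)
    (if `[< box (ratr a) (ratr b) (ratr c) n `<=` U >] then
       box (ratr a) (ratr b) (ratr c) n else set0).
  apply/seteqP; split => [[[x y] z] Ux|x]; last first.
    by move=> [n _ [a _ [b _ [c _]]]]; case: ifPn => // /asboolP; apply.
  have /nbhs_ballP[e /= e0 eU] : nbhs ((x, y), z) U by exact: open_nbhs_nbhs.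
  have [n en] : exists n : nat, n.+1%:R^-1 < e / 2.
    have e2 : 0 < e / 2 by rewrite divr_gt0.
    have [n _ /(_ _ (leqnn n))] := near_infty_natSinv_lt (PosNum e2).
    by exists n.
  have d0 : 0 < n.+1%:R^-1 :> R by rewrite invr_gt0.
  set d : R := n.+1%:R^-1 in en d0.
  have rat_near (t : R) : exists a : rat, t \in `]ratr a - d, ratr a + d[.
    have tt : t - d < t + d by lra.
    have [a] := rat_in_itvoo tt; rewrite in_itv/= => /andP[a1 a2].
    by exists a; rewrite in_itv/=; apply/andP; split; lra.
  have [a xa] := rat_near x; have [b yb] := rat_near y; have [c zc] := rat_near z.
  exists n => //; exists a => //; exists b => //; exists c => //.
  rewrite ifT; first by split => //; split.
  rewrite !in_itv/= in xa yb zc.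
  have inI (s t v : R) : `]s, t[%classic v -> s < v < t by rewrite /= in_itv.
  apply/asboolP; rewrite /box -/d => -[[x' y'] z'] [[]].
  move=> /inI/andP[/= ? ?] /inI/andP[/= ? ?] /inI/andP[/= ? ?]; apply: eU.
  move: xa yb zc => /andP[? ?] /andP[? ?] /andP[? ?].
  by split; [split|]; rewrite /ball/= ltr_norml; apply/andP; split; lra.
apply: bigcupT_measurable => n; do 3!apply: bigcupT_measurable_rat => ?.
by case: ifPn => // _; do !apply: measurableX; exact: measurable_itv.
Qed.

Lemma continuous_measurable_space (f : P -> R) : continuous f ->
  measurable_fun [set: MP] (f : MP -> MR).
Proof.
move=> /continuousP cf; apply: (measurability _ (RGenOpens.measurableE R)).
move=> _ [_ [a [b ->] <-]]; rewrite setTI; apply: open_measurable_space.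
exact/cf/interval_open.
Qed.

Definition box2 (M : R) : set (MR * MR) := `[- M, M] `*` `[- M, M].
Definition box3 (M : R) : set MP := box2 M `*` `[- M, M].

Lemma measurable_box2 M : measurable (box2 M).
Proof. by apply: measurableX; exact: measurable_itv. Qed.

Lemma measurable_box3 M : measurable (box3 M).
Proof. by apply: measurableX; [exact: measurable_box2|exact: measurable_itv]. Qed.

Lemma leb1_fin (M : R) : (@lebesgue_measure R `[(- M)%R, M] < +oo)%E.
Proof. by rewrite lebesgue_measure_itv; case: ifPn => // _; rewrite -EFinB ltry. Qed.

Lemma leb2_box_fin M : (@leb2 R (box2 M) < +oo)%E.
Proof.
rewrite /leb2 product_measure1E; [|exact: measurable_itv|exact: measurable_itv].
by rewrite lte_mul_pinfty// ?leb1_fin// ge0_fin_numE// leb1_fin.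
Qed.

Lemma leb3_box_fin M : (@leb3 R (box3 M) < +oo)%E.
Proof.
rewrite /leb3 product_measure1E; [|exact: measurable_box2|exact: measurable_itv].
by rewrite lte_mul_pinfty// ?leb1_fin// ge0_fin_numE// leb2_box_fin.
Qed.

Lemma integrable_support d (T : measurableType d) (mu : {measure set T -> \bar R})
    (A : set T) (f : T -> R) K : measurable A -> (mu A < +oo)%E ->
  measurable_fun setT f -> (forall x, A x -> `|f x| <= K) ->
  (forall x, ~ A x -> f x = 0) -> mu.-integrable setT (EFin \o f).
Proof.
move=> mA muA mf fK f0.
have -> : EFin \o f = (EFin \o f) \_ A.
  apply/funext => x; rewrite patchE; case: ifPn => //= /negP.
  by rewrite inE => /f0 ->.
apply/(integrable_mkcond _ mA); apply: measurable_bounded_integrable => //.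
  exact: measurable_funS mf.
exists `|K|; split; first exact: num_real.
move=> y Ky x Ax /=; rewrite (le_trans (fK x Ax))// (le_trans (ler_norm _))// ltW//.
Qed.

Lemma compact_box3 M : compact (box3 M : set P).
Proof.
have c : compact (`[- M, M] : set R) by exact: segment_compact.
exact: compact_setX (compact_setX c c) c.
Qed.

Lemma bounded_box3 (f : P -> R) M : continuous f -> exists2 K, 0 <= K &
  forall x, box3 M x -> `|f x| <= K.
Proof.
move=> cf; have cF : continuous (fun x => `|f x|).
  by move=> x; apply: cvg_norm; exact: cf.
have [[x0 bx0]|be] := pselect (box3 M !=set0); last first.
  by exists 0 => // x bx; case: be; exists x.
have [c _ H] := compact_EVT_max (ex_intro _ x0 bx0) (@compact_box3 M)
  (continuous_subspaceT cF).
by exists `|f c| => // x bx; apply: H; rewrite inE.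
Qed.

(** The fundamental theorem of calculus on [- M, M]. *)
Lemma integral_derivative0 (F F' : R -> R) M : 0 < M ->
  (forall x, is_derive x (1 : R) F (F' x)) -> continuous F' ->
  (forall x, M < `|x| -> F' x = 0) -> F M = 0 -> F (- M) = 0 ->
  (\int[@lebesgue_measure R]_x (F' x)%:E = 0)%E.
Proof.
move=> M0 dF cF' F'0 FM FM'.
have -> : (fun x => (F' x)%:E) = (EFin \o F') \_ `[- M, M].
  apply/funext => x; rewrite patchE; case: ifPn => // /negP xM.
  rewrite F'0// ltNge; apply/negP => Mx; apply: xM.
  by rewrite inE/= in_itv/= -ler_norml.
rewrite -integral_mkcond.
have MM : - M < M by lra.
have cF x : {for x, continuous F}.
  by apply/differentiable_continuous/derivable1_diffP; have [] := dF x.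
rewrite (continuous_FTC2 (F := F) MM).
- by rewrite FM FM' subee.
- exact: continuous_subspaceT.
- split; first by move=> x _; have [] := dF x.
    by apply: cvg_at_right_filter; exact: cF.
  by apply: cvg_at_left_filter; exact: cF.
- by move=> x _; rewrite derive1E; have [_ ->] := dF x.
Qed.

End Measure.

Section Divergence.
Variable R : realType.
Notation P := (R * R * R)%type.
Notation MR := (measurableTypeR R).
Notation MP := (MR * MR * MR)%type.
Implicit Types (f : P -> R).

(** The paths p meant here are the lines parallel to the axes, parametrized by
    one coordinate. *)
Lemma is_derive_slice f (p : R -> P) v t a :
  (forall h, p (h + t) = h *: v + p t) ->
  is_derive (p t) v f a -> is_derive t (1 : R) (fun s => f (p s)) a.
Proof.
move=> pE [df da].
have E : (fun h : R => h^-1 *: (((fun s => f (p s)) \o shift t) (h *: 1) - f (p t)))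
       = (fun h => h^-1 *: ((f \o shift (p t)) (h *: v) - f (p t))).
  by apply/funext => h /=; rewrite [h *: 1]mulr1 pE.
apply: DeriveDef; first by rewrite /derivable E.
by rewrite -da /derive E.
Qed.

Lemma closed_box3 M : closed (box3 M : set P).
Proof.
have H : hausdorff_space P by exact: norm_hausdorff.
exact: (@compact_closed P _ H (@compact_box3 R M)).
Qed.

Lemma box3_crd (M : R) (x : P) : box3 M x ->
  [/\ `|x.1.1| <= M, `|x.1.2| <= M & `|x.2| <= M].
Proof.
have inI (v : R) : `[- M, M]%classic v -> `|v| <= M.
  by rewrite /= in_itv/= -ler_norml.
by case: x => -[x y] z [[]] /inI ? /inI ? /inI ?; split.
Qed.

Lemma partial_outside i f M : (forall x, ~ box3 M x -> f x = 0) ->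
  forall x, ~ box3 M x -> partial i f x = 0.
Proof.
move=> f0 x xM; rewrite /partial (@near_eq_derive _ _ _ _ (cst 0)) ?derive_cst//.
have : nbhs x (~` (box3 M : set P)).
  by apply: open_nbhs_nbhs; split => //; apply: closed_openC; exact: closed_box3.
by apply: filterS => y /f0.
Qed.

(** Fubini's theorem is used with the variable x_i innermost; the inner integral
    then vanishes on every line. *)
Lemma integral_partial0 i f M : 0 < M -> (forall x, differentiable f x) ->
  continuous (partial i f) -> (forall x, ~ box3 M x -> f x = 0) ->
  (@leb3 R).-integrable setT (EFin \o partial i f) /\
  (\int[@leb3 R]_x (partial i f x)%:E = 0)%E.
Proof.
move=> M0 df cf f0; have p0 := partial_outside i f0.
have [K K0 HK] := bounded_box3 M cf.
have mf := continuous_measurable_space cf.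
have If : (@leb3 R).-integrable setT (EFin \o partial i f).
  exact: (integrable_support (measurable_box3 M) (leb3_box_fin M) mf HK p0).
split => //.
have pair_continuous (U V W : topologicalType) (a : U -> V) (b : U -> W) :
    continuous a -> continuous b -> continuous (fun u => (a u, b u)).
  by move=> ca cb u; apply: cvg_pair; [exact: ca|exact: cb].
have idc : continuous (id : R -> R) by move=> ?; exact: cvg_id.
have cstc (U : topologicalType) (c : U) : continuous (fun _ : R => c).
  by move=> ?; exact: cvg_cst.
have slice0 (p : R -> P) : continuous p ->
    (forall t h, p (h + t) = h *: basis3 R i + p t) ->
    (forall t, M < `|t| -> ~ box3 M (p t)) ->
    (\int[@lebesgue_measure R]_t (partial i f (p t))%:E = 0)%E.
  move=> cp pE pM.
  (* f vanishes outside the closed box only, hence the endpoints M + 1. *)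
  have M1 : 0 < M + 1 by lra.
  have nM : M < `|M + 1| by rewrite ger0_norm; lra.
  apply: (@integral_derivative0 R (fun t => f (p t)) _ (M + 1)) => //.
  - move=> t; apply: is_derive_slice (pE t) _.
    exact: is_derive_partial.
  - by move=> t; apply: continuous_comp; [exact: cp|exact: cf].
  - by move=> t Mt; apply/p0/pM; lra.
  - exact/f0/pM.
  - by apply/f0/pM; rewrite normrN.
have Iz (z : MR) :
    (@leb2 R).-integrable setT (EFin \o fun u : MR * MR => partial i f (u, z)).
  have mfz : measurable_fun setT (fun u : MR * MR => partial i f (u, z)).
    exact: (measurableT_comp mf).
  apply: (integrable_support (measurable_box2 M) (leb2_box_fin M) mfz (K := K)).
    move=> u bu; have [zM|zM] := pselect (`[- M, M]%classic z); first exact: HK.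
    by rewrite p0 ?normr0// => -[].
  by move=> u bu; apply: p0 => -[].
clear p0 cf mf HK; elim/ord3_ind : i If slice0 Iz => If slice0 Iz.
- rewrite -[LHS](integral21_prod_meas1 (m1 := @leb2 R) (m2 := @lebesgue_measure R) If).
  apply: integral0_eq => z _; rewrite /fubini_G.
  rewrite -[LHS](integral21_prod_meas1 (m1 := @lebesgue_measure R)
    (m2 := @lebesgue_measure R) (Iz z)).
  apply: integral0_eq => y _; rewrite /fubini_G.
  apply: (slice0 (fun t => ((t, y), z))) => [|t h|t Mt].
  + by apply: (pair_continuous) => //; apply: (pair_continuous).
  + by transitivity (h * 1 + t, h * 0 + y, h * 0 + z); [rewrite !(mulr1, mulr0, add0r)|].
  + by move=> /box3_crd[/= tM _ _]; lra.
- rewrite -[LHS](integral21_prod_meas1 (m1 := @leb2 R) (m2 := @lebesgue_measure R) If).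
  apply: integral0_eq => z _; rewrite /fubini_G.
  rewrite -[LHS](integral12_prod_meas1 (m1 := @lebesgue_measure R)
    (m2 := @lebesgue_measure R) (Iz z)).
  apply: integral0_eq => x _; rewrite /fubini_F.
  apply: (slice0 (fun t => ((x, t), z))) => [|t h|t Mt].
  + by apply: (pair_continuous) => //; apply: (pair_continuous).
  + by transitivity (h * 0 + x, h * 1 + t, h * 0 + z); [rewrite !(mulr1, mulr0, add0r)|].
  + by move=> /box3_crd[/= _ tM _]; lra.
- rewrite -[LHS](integral12_prod_meas1 (m1 := @leb2 R) (m2 := @lebesgue_measure R) If).
  apply: integral0_eq => -[x y] _; rewrite /fubini_F.
  apply: (slice0 (fun t => ((x, y), t))) => [|t h|t Mt].
  + exact: pair_continuous.
  + by transitivity (h * 0 + x, h * 0 + y, h * 1 + t); [rewrite !(mulr1, mulr0, add0r)|].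
  + by move=> /box3_crd[/= _ _ tM]; lra.
Qed.

End Divergence.

(** * Limits of integrals and square-integrable functions *)

Section Integrals.
Context d (T : measurableType d) (R : realType).
Variables (mu : {measure set T -> \bar R}) (A : set T).
Hypotheses (mA : measurable A) (muA : (mu A < +oo)%E).
Implicit Types (f g : T -> R).

Notation int := (mu.-integrable A).

Lemma integrable_bounded f K : measurable_fun A f ->
  (forall x, A x -> `|f x| <= K) -> int (EFin \o f).
Proof.
move=> mf fK; apply: measurable_bounded_integrable => //.
exists `|K|; split; first exact: num_real.
move=> y Ky x Ax /=; rewrite (le_trans (fK x Ax))// (le_trans (ler_norm _))// ltW//.
Qed.

Lemma integrable_mul_bounded f g K : int (EFin \o f) -> measurable_fun A g ->
  (forall x, A x -> `|g x| <= K) -> int (EFin \o (fun x => f x * g x)).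
Proof.
move=> If mg gK.
have -> : EFin \o (fun x => f x * g x) = ((EFin \o f) \* (EFin \o g))%E.
  by apply/funext => x /=; rewrite EFinM.
apply: integrableMl => //; exists `|K|; split; first exact: num_real.
move=> y Ky x Ax /=; rewrite (le_trans (gK x Ax))// (le_trans (ler_norm _))// ltW//.
Qed.

Lemma integrable_add f g : int (EFin \o f) -> int (EFin \o g) ->
  int (EFin \o (fun x => f x + g x)).
Proof.
move=> If Ig; rewrite (_ : EFin \o _ = (EFin \o f) \+ (EFin \o g))%E.
  exact: integrableD.
by apply/funext => x /=; rewrite EFinD.
Qed.

Lemma integrable_sub f g : int (EFin \o f) -> int (EFin \o g) ->
  int (EFin \o (fun x => f x - g x)).
Proof.
move=> If Ig; rewrite (_ : EFin \o _ = (EFin \o f) \- (EFin \o g))%E.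
  exact: integrableB.
by apply/funext => x /=; rewrite EFinB.
Qed.

(** Dominated convergence in the form used throughout: the approximating
    integrands have integral 0 and are eventually equal to the limit at each
    point. *)
Lemma Rintegral_limit0 (f_ : nat -> T -> R) f g :
  (forall n, measurable_fun A (f_ n)) ->
  (forall x, A x -> \forall n \near \oo, f_ n x = f x) ->
  int (EFin \o g) -> (forall n x, A x -> `|f_ n x| <= g x) ->
  (forall n, Rintegral mu A (f_ n) = 0) -> Rintegral mu A f = 0.
Proof.
move=> mf f_f Ig f_g f_0.
have cvg x : A x -> f_ ^~ x @ \oo --> f x.
  move=> Ax; apply: cvg_near_cst; exact: f_f.
have cvgE x : A x -> (fun n => (EFin \o f_ n) x) @ \oo --> (EFin \o f) x.
  by move=> Ax; apply: cvg_near_cst; apply: filterS (f_f x Ax) => n /= ->.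
have fgE x n : A x -> (`|(EFin \o f_ n) x| <= (EFin \o g) x)%E.
  by move=> Ax; rewrite /= lee_fin; exact: f_g.
have mfl : measurable_fun A f by exact: measurable_fun_cvg mf cvg.
have [_ _] := @dominated_convergence _ _ _ mu A mA (fun n => EFin \o f_ n)
  (EFin \o f) (EFin \o g) (fun n => (measurable_EFinP _ _).2 (mf n))
  ((measurable_EFinP _ _).2 mfl)
  (aeW _ cvgE) Ig
  (aeW _ fgE).
have If n : int (EFin \o f_ n).
  apply: le_integrable Ig => //; first exact/measurable_EFinP.
  by move=> x Ax /=; rewrite lee_fin (le_trans (f_g n x Ax))// ler_norm.
have -> : (fun n => (\int[mu]_(x in A) (EFin \o f_ n) x)%E) = (fun=> 0%E).
  apply/funext => n; rewrite -[LHS]fineK; first by congr EFin; exact: f_0.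
  exact: integrable_fin_num.
move=> H; rewrite /Rintegral.
have -> : (\int[mu]_(x in A) (f x)%:E = 0)%E; last by [].
by apply: (cvg_unique _ H) => //; exact: cvg_cst.
Qed.

Lemma Lfun2_bounded f K : measurable_fun A f ->
  (forall x, A x -> `|f x| <= K) -> f \_ A \in Lfun mu 2%:E.
Proof.
move=> mf fK; have mfA := (measurable_restrictT f mA).1 mf.
rewrite inE; apply/andP; split; rewrite inE//=.
rewrite /finite_norm unlock poweR_lty//.
have If : int (EFin \o (fun x => `|f x| `^ 2)).
  apply: (@integrable_bounded _ (K ^+ 2)) => [|x Ax].
    apply: (measurableT_comp (measurable_powR _)) => //; exact: measurableT_comp.
  rewrite ger0_norm ?powR_ge0// powR_mulrn// lerXn2r ?nnegrE ?fK//.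
  exact: le_trans (fK x Ax).
have := integrable_lty mA If; rewrite integral_mkcond.
apply: le_lt_trans; rewrite le_eqVlt; apply/orP; left; apply/eqP.
apply: eq_integral => x _; rewrite /= !patchE; case: ifPn => // _.
by rewrite normr0 powR0// pnatr_eq0.
Qed.

(** From |f| <= 1 + f^2 and the finiteness of the measure of the domain. *)
Lemma Lfun2_integrable f : f \_ A \in Lfun mu 2%:E -> int (EFin \o f).
Proof.
move=> /[dup] Lf /Lfun2_integrable_sqr Isq.
have mf : measurable_fun A f.
  apply/(measurable_restrictT f mA).2.
  by move: Lf; rewrite inE => /andP[]; rewrite inE.
have {}Isq := integrableS measurableT mA (@subsetT _ _) Isq.
have I1 : int (EFin \o (fun=> 1 : R)).
  by apply: (@integrable_bounded _ 1) => // x _; rewrite normr1.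
apply: (le_integrable mA _ _ (integrable_add Isq I1)).
  exact/measurable_EFinP.
move=> x Ax /=; rewrite lee_fin patchE mem_set//.
rewrite [leRHS]ger0_norm; last by rewrite addr_ge0// sqr_ge0.
have := sqr_ge0 (`|f x| - 1); have := sqr_ge0 (f x); have := normr_ge0 (f x).
by rewrite sqrrB1 real_normK ?num_real//=; lra.
Qed.

End Integrals.

(** * Green's formula for the curl *)

Section Fields.
Variable R : realType.
Notation P := (R * R * R)%type.
Notation MR := (measurableTypeR R).
Notation MP := (MR * MR * MR)%type.
Implicit Types (f : P -> R) (u v : 'rV[R]_3) (E phi : P -> 'rV[R]_3).

Definition dot3 u v : R := \sum_(i < 3) u ord0 i * v ord0 i.

Lemma sum3E (V : nmodType) (F : 'I_3 -> V) : \sum_(i < 3) F i = F i0 + F i1 + F i2.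
Proof.
rewrite !big_ord_recl big_ord0 addr0 addrA.
by congr (F _ + F _ + F _); exact: val_inj.
Qed.

Lemma dot3_bound u v a b : 0 <= a -> 0 <= b -> (forall i, `|u ord0 i| <= a) ->
  (forall i, `|v ord0 i| <= b) -> `|dot3 u v| <= 3 * (a * b).
Proof.
move=> a0 b0 ua vb; rewrite /dot3 (le_trans (ler_norm_sum _ _ _))//.
rewrite (_ : 3 * (a * b) = \sum_(i < 3) a * b); last by rewrite sum3E; ring.
by apply: ler_sum => i _; rewrite normrM ler_pM.
Qed.

Lemma elementary_continuous f : elementary f -> continuous f.
Proof. by move=> ef x; exact/differentiable_continuous/elementary_differentiable. Qed.

Lemma smooth_continuous f : smooth f -> continuous f.
Proof. by move=> sf x; apply: differentiable_continuous; exact: (sf [::]). Qed.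

Lemma smooth_partial_continuous i f : smooth f -> continuous (partial i f).
Proof. by move=> sf x; apply: differentiable_continuous; exact: (sf [:: i]). Qed.

Let null f := (@leb3 R).-integrable setT (EFin \o f) /\ Rintegral (@leb3 R) setT f = 0.

Let nullD f g : null f -> null g -> null (fun x => f x + g x).
Proof.
move=> [If f0] [Ig g0]; split; first exact: integrable_add.
by rewrite RintegralD// f0 g0 addr0.
Qed.

Let nullB f g : null f -> null g -> null (fun x => f x - g x).
Proof.
move=> [If f0] [Ig g0]; split; first exact: integrable_sub.
by rewrite RintegralB// f0 g0 subr0.
Qed.

(** H . phi - E . curl phi is the divergence of E x phi when H = curl E. *)
Lemma green E phi M : 0 < M -> (forall i, elementary (fun x => E x ord0 i)) ->
  (forall i, smooth (fun x => phi x ord0 i)) ->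
  (forall x, ~ box3 M x -> E x = 0) ->
  Rintegral (@leb3 R) setT
    (fun x => dot3 (curl E x) (phi x) - dot3 (E x) (curl phi x)) = 0.
Proof.
move=> M0 eE sphi E0.
pose e i x := E x ord0 i; pose p i x := phi x ord0 i.
have dE i j x := is_derive_partial j (elementary_differentiable (eE i) x).
have dp i j x := is_derive_partial j (sphi i [::] x).
have prod i j k : partial i (fun x => e j x * p k x) =
    fun x => e j x * partial i (p k) x + p k x * partial i (e j) x.
  by apply: partial_unique => x; exact: is_derive_fmul (dE j i x) (dp k i x).
have N i j k : null (partial i (fun x => e j x * p k x)).
  suff [I0 I1] : (@leb3 R).-integrable setT (EFin \o partial i (fun x => e j x * p k x)) /\
     (\int[@leb3 R]_x (partial i (fun x => e j x * p k x) x)%:E = 0)%E.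
    by split => //; rewrite /Rintegral I1.
  apply: (@integral_partial0 _ i _ M) => //.
  - move=> x; apply: differentiableM; first exact: (elementary_differentiable (eE j) x).
    exact: (sphi k [::] x).
  - rewrite prod => x; apply: cvgD; apply: cvgM.
    + exact: (elementary_continuous (eE j)).
    + exact: (smooth_partial_continuous (sphi k)).
    + exact: (smooth_continuous (sphi k)).
    + exact: (elementary_continuous (elementary_partial i (eE j))).
  - by move=> x xM; rewrite /e E0// mxE mul0r.
have [_ <-] := nullD (nullD (nullB (N i0 i1 i2) (N i0 i2 i1))
  (nullB (N i1 i2 i0) (N i1 i0 i2))) (nullB (N i2 i0 i1) (N i2 i1 i0)).
congr (Rintegral _ _ _); apply/funext => x; rewrite !prod /dot3 !sum3E !curl_vec3.
pose D (d : 'I_3 -> 'I_3 -> R) :=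
  vec3 (d i1 i2 - d i2 i1) (d i2 i0 - d i0 i2) (d i0 i1 - d i1 i0).
have key (d d' : 'I_3 -> 'I_3 -> R) (a b : 'I_3 -> R) :
    D d ord0 i0 * b i0 + D d ord0 i1 * b i1 + D d ord0 i2 * b i2
    - (a i0 * D d' ord0 i0 + a i1 * D d' ord0 i1 + a i2 * D d' ord0 i2)
    = a i1 * d' i0 i2 + b i2 * d i0 i1 - (a i2 * d' i0 i1 + b i1 * d i0 i2)
      + (a i2 * d' i1 i0 + b i0 * d i1 i2 - (a i0 * d' i1 i2 + b i2 * d i1 i0))
      + (a i0 * d' i2 i1 + b i1 * d i2 i0 - (a i1 * d' i2 i0 + b i0 * d i2 i1)).
  have DE c : [/\ D c ord0 i0 = c i1 i2 - c i2 i1, D c ord0 i1 = c i2 i0 - c i0 i2 &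
      D c ord0 i2 = c i0 i1 - c i1 i0] by exact: vec3E.
  by have [-> -> ->] := DE d; have [-> -> ->] := DE d'; ring.
exact: (key (fun i j => partial i (e j) x) (fun i j => partial i (p j) x)
  (fun j => e j x) (fun j => p j x)).
Qed.

Lemma eballE (r : R) (x : P) : 0 < r -> eball r x <-> normsq x < r ^+ 2.
Proof.
move=> r0; rewrite /eball/= /enorm.
rewrite -{1}(ger0_norm (ltW r0)) -sqrtr_sqr ltr_sqrt ?exprn_gt0//.
Qed.

Lemma normsq_ge0 (x : P) : 0 <= normsq x.
Proof. by rewrite /normsq !addr_ge0// sqr_ge0. Qed.

Lemma normsq_continuous : continuous (@normsq R).
Proof. exact: (elementary_continuous (elementary_radial (@Cinf_id R))). Qed.

Lemma crd_le i (x : P) (M : R) : 0 <= M -> normsq x <= M ^+ 2 -> `|crd i x| <= M.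
Proof.
move=> M0 xM; rewrite -(ler_pXn2r (n := 2)) ?nnegrE// real_normK ?num_real//.
apply: le_trans xM; rewrite /normsq.
have := sqr_ge0 (crd i0 x); have := sqr_ge0 (crd i1 x); have := sqr_ge0 (crd i2 x).
by elim/ord3_ind : i; lra.
Qed.

Lemma normsq_box3 (x : P) (M : R) : 0 <= M -> normsq x <= M ^+ 2 -> box3 M x.
Proof.
move=> M0 xM; have c i := crd_le i M0 xM.
have inI (v : R) : `|v| <= M -> `[- M, M]%classic v by rewrite /= in_itv/= -ler_norml.
by split; [split|]; apply: inI; [exact: (c i0)|exact: (c i1)|exact: (c i2)].
Qed.

Lemma measurable_eball (r : R) : 0 < r -> measurable (eball r : set MP).
Proof.
move=> r0; apply: open_measurable_space.
rewrite (_ : eball r = (@normsq R) @^-1` [set t | t < r ^+ 2]); last first.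
  by apply/funext => x; apply/propext; exact: eballE.
by apply: open_comp; [move=> x _; exact: normsq_continuous|exact: open_lt].
Qed.

Lemma leb3_eball (r : R) : 0 < r -> (@leb3 R (eball r : set MP) < +oo)%E.
Proof.
move=> r0; apply: le_lt_trans (leb3_box_fin r).
apply: le_measure; rewrite ?inE; [exact: measurable_eball|exact: measurable_box3|].
by move=> x /(eballE _ r0) xr; apply: normsq_box3; exact: ltW.
Qed.

Lemma elementary_toroidal i (h : R -> R) :
  Cinf h -> elementary (fun x => toroidal h x ord0 i).
Proof.
move=> Ch; have cE x := vec3E (- (crd i1 x * h (normsq x))) (crd i0 x * h (normsq x)) 0.
elim/ord3_ind : i.
- rewrite (_ : (fun _ => _) = fun x => -1 * (crd i1 x * h (normsq x))).
    apply: elementary_mul; first exact: elementary_cst.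
    by apply: elementary_mul; [exact: elementary_crd|exact: elementary_radial].
  by apply/funext => x; have [-> _ _] := cE x; rewrite mulN1r.
- rewrite (_ : (fun _ => _) = fun x => crd i0 x * h (normsq x)).
    by apply: elementary_mul; [exact: elementary_crd|exact: elementary_radial].
  by apply/funext => x; have [_ -> _] := cE x.
- rewrite (_ : (fun _ => _) = fun x => 0); first exact: elementary_cst.
  by apply/funext => x; have [_ _ ->] := cE x.
Qed.

Lemma elementary_curl i E : (forall j, elementary (fun x => E x ord0 j)) ->
  elementary (fun x => curl E x ord0 i).
Proof.
move=> eE; have sub f g : elementary f -> elementary g -> elementary (fun x => f x - g x).
  move=> ef eg; rewrite (_ : (fun _ => _) = fun x => f x + -1 * g x).
    by apply: elementary_add => //; apply: elementary_mul => //; exact: elementary_cst.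
  by apply/funext => x; rewrite mulN1r.
rewrite (_ : (fun _ => _) = fun x => partial (i + 1) (fun y => E y ord0 (i + 1 + 1)) x
     - partial (i + 1 + 1) (fun y => E y ord0 (i + 1)) x).
  by apply: sub; apply: elementary_partial.
by apply/funext => x; rewrite mxE.
Qed.

Lemma toroidal_bound i (h : R -> R) (r : R) (x : P) K :
  0 < r -> 0 <= K -> normsq x <= r ^+ 2 ->
  `|h (normsq x)| <= K -> `|toroidal h x ord0 i| <= r * K.
Proof.
move=> r0 K0 xr hK; have rK : 0 <= r * K by rewrite mulr_ge0// ltW.
have c j := crd_le j (ltW r0) xr.
have [e0 e1 e2] := vec3E (- (crd i1 x * h (normsq x))) (crd i0 x * h (normsq x)) 0.
elim/ord3_ind : i; rewrite /toroidal.
- by rewrite e0 normrN normrM ler_pM.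
- by rewrite e1 normrM ler_pM.
- by rewrite e2 normr0.
Qed.

Lemma poloidal_bound i (h h' : R -> R) (r : R) (x : P) K :
  0 < r -> 0 <= K -> normsq x <= r ^+ 2 ->
  `|h (normsq x)| <= K -> `|h' (normsq x)| <= K ->
  `|poloidal h h' x ord0 i| <= 2 * K + 4 * (r * r * K).
Proof.
move=> r0 K0 xr hK h'K; have rK : 0 <= r * r * K by rewrite !mulr_ge0// ltW.
have c j := crd_le j (ltW r0) xr.
have [e0 e1 e2] := vec3E (- (2 * (crd i0 x * crd i2 x * h' (normsq x))))
       (- (2 * (crd i1 x * crd i2 x * h' (normsq x))))
       (2 * h (normsq x) + 2 * ((crd i0 x ^+ 2 + crd i1 x ^+ 2) * h' (normsq x))).
have cc j k : `|crd j x * crd k x * h' (normsq x)| <= r * r * K.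
  by rewrite !normrM !ler_pM// mulr_ge0.
elim/ord3_ind : i; rewrite /poloidal.
- by rewrite e0 normrN normrM (@ger0_norm _ 2)//; have := cc i0 i2; lra.
- by rewrite e1 normrN normrM (@ger0_norm _ 2)//; have := cc i1 i2; lra.
- rewrite e2 (_ : _ + _ = 2 * h (normsq x) + (2 * (crd i0 x * crd i0 x * h' (normsq x))
    + 2 * (crd i1 x * crd i1 x * h' (normsq x)))); last by ring.
  rewrite (le_trans (ler_normD _ _))// normrM (@ger0_norm _ 2)//.
  rewrite lerD//; first by rewrite ler_wpM2l.
  rewrite (le_trans (ler_normD _ _))// normrM (normrM 2 (crd i1 x * _ * _)).
  rewrite (@ger0_norm _ 2)//.
  by have := cc i0 i0; have := cc i1 i1; lra.
Qed.

Lemma continuous_measurable_on (f : P -> R) (A : set MP) : continuous f ->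
  measurable_fun A (f : MP -> MR).
Proof. by move=> cf; apply: measurable_funS (continuous_measurable_space cf). Qed.

Lemma continuous_dot3 (u v : P -> 'rV[R]_3) :
  (forall i, continuous (fun x => u x ord0 i)) ->
  (forall i, continuous (fun x => v x ord0 i)) ->
  continuous (fun x => dot3 (u x) (v x)).
Proof.
move=> cu cv; rewrite (_ : (fun _ => _) = fun x => u x ord0 i0 * v x ord0 i0 +
    u x ord0 i1 * v x ord0 i1 + u x ord0 i2 * v x ord0 i2).
  by move=> x; exact: (cvgD (cvgD (cvgM (cu i0 x) (cv i0 x))
    (cvgM (cu i1 x) (cv i1 x))) (cvgM (cu i2 x) (cv i2 x))).
by apply/funext => x; rewrite /dot3 sum3E.
Qed.

Lemma measurable_dot3 (A : set MP) (u v : P -> 'rV[R]_3) :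
  (forall i, measurable_fun A ((fun x => u x ord0 i) : MP -> MR)) ->
  (forall i, measurable_fun A ((fun x => v x ord0 i) : MP -> MR)) ->
  measurable_fun A ((fun x => dot3 (u x) (v x)) : MP -> MR).
Proof.
move=> mu mv; rewrite (_ : (fun _ => _) = fun x => u x ord0 i0 * v x ord0 i0 +
    u x ord0 i1 * v x ord0 i1 + u x ord0 i2 * v x ord0 i2).
  exact: (measurable_funD (measurable_funD (measurable_funM (mu i0) (mv i0))
    (measurable_funM (mu i1) (mv i1))) (measurable_funM (mu i2) (mv i2))).
by apply/funext => x; rewrite /dot3 sum3E.
Qed.

Lemma continuous_curl (phi : P -> 'rV[R]_3) :
  (forall i, smooth (fun x => phi x ord0 i)) ->
  forall i, continuous (fun x => curl phi x ord0 i).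
Proof.
move=> sphi i; rewrite (_ : (fun _ => _) = fun x =>
    partial (i + 1) (fun y => phi y ord0 (i + 1 + 1)) x
    - partial (i + 1 + 1) (fun y => phi y ord0 (i + 1)) x).
  by move=> x; apply: cvgB; apply: smooth_partial_continuous; exact: sphi.
by apply/funext => x; rewrite mxE.
Qed.

Lemma bounded_on_eball (r : R) (u : P -> 'rV[R]_3) : 0 < r ->
  (forall i, continuous (fun x => u x ord0 i)) ->
  exists2 K, 0 <= K & forall x i, eball r x -> `|u x ord0 i| <= K.
Proof.
move=> r0 cu.
have [K0 K00 H0] := bounded_box3 r (cu i0); have [K1 K10 H1] := bounded_box3 r (cu i1).
have [K2 K20 H2] := bounded_box3 r (cu i2).
exists (K0 + K1 + K2) => [|x i /(eballE _ r0) xr]; first by rewrite !addr_ge0.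
have bx := normsq_box3 (ltW r0) (ltW xr).
have := H0 x bx; have := H1 x bx; have := H2 x bx.
by elim/ord3_ind : i; lra.
Qed.

End Fields.

(** * The mode satisfies the weak equations *)

Section Mode.
Variable R : realType.
Notation P := (R * R * R)%type.
Notation MR := (measurableTypeR R).
Notation MP := (MR * MR * MR)%type.
Variables (r lam : R) (g e : R -> R).
Hypothesis r1 : 1 < r.
Hypotheses (Cg : Cinf g) (Ce : Cinf e).
Hypotheses (ge1 : g 1 = e 1) (ge1' : der g 1 = der e 1) (er : e (r ^+ 2) = 0).
Hypothesis odeg : forall q : R, 0 < q ->
  4 * q * der (der g) q + 10 * der g q = - lam * g q.
Hypothesis odee : forall q : R, 1 <= q -> 4 * q * der (der e) q + 10 * der e q = 0.

Let r0 : 0 < r. Proof. by apply: lt_trans r1. Qed.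
Let B1 : 1 < r ^+ 2. Proof. by rewrite expr_gt1// ltW. Qed.

Definition modeE : P -> 'rV[R]_3 := toroidal (piecewise g e).
Definition modeH : P -> 'rV[R]_3 := poloidal (piecewise g e) (piecewise (der g) (der e)).

Notation Om := (eball r : set MP).
Let mOm : measurable Om. Proof. exact: measurable_eball. Qed.
Let Omfin : (@leb3 R Om < +oo)%E. Proof. exact: leb3_eball. Qed.

(** Measurability and bounds are inherited from the smooth approximations, of
    which E and H are pointwise limits. *)
Lemma mode_regular : exists2 K : R, 0 <= K & forall i,
  [/\ measurable_fun Om ((fun x => modeE x ord0 i) : MP -> MR),
      measurable_fun Om ((fun x => modeH x ord0 i) : MP -> MR)
    & forall x, Om x -> `|modeE x ord0 i| <= K /\ `|modeH x ord0 i| <= K].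
Proof.
have [k [Ck k0 [K K0 kK] kE]] := approx_trace Cg Ce B1 ge1 ge1' er.
have ne x : Om x -> \forall n \near \oo, toroidal (k n) x = modeE x /\
    poloidal (k n) (der (k n)) x = modeH x.
  move=> /(eballE _ r0) xr; apply: filterS (kE _ xr) => n [h0 h1].
  by rewrite /modeE /modeH /toroidal /poloidal h0 h1.
have cE n i : continuous (fun x => toroidal (k n) x ord0 i).
  exact: elementary_continuous (elementary_toroidal i (Ck n)).
have cH n i : continuous (fun x => poloidal (k n) (der (k n)) x ord0 i).
  have := elementary_continuous (elementary_curl i (fun j => elementary_toroidal j (Ck n))).
  by rewrite curl_toroidal.
have rK : 0 <= r * K by rewrite mulr_ge0// ltW.
have rrK : 0 <= r * r * K by rewrite !mulr_ge0// ltW.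
exists (r * K + (2 * K + 4 * (r * r * K))); first lra.
move=> i; split.
- apply: (@measurable_fun_cvg _ _ _ Om (fun n x => toroidal (k n) x ord0 i)).
    by move=> n; apply: continuous_measurable_on.
  by move=> x Ox; apply: cvg_near_cst; apply: filterS (ne x Ox) => n [-> _].
- apply: (@measurable_fun_cvg _ _ _ Om (fun n x => poloidal (k n) (der (k n)) x ord0 i)).
    by move=> n; apply: continuous_measurable_on.
  by move=> x Ox; apply: cvg_near_cst; apply: filterS (ne x Ox) => n [_ ->].
- move=> x Ox; have [n [<- <-]] := filter_ex (ne x Ox).
  have xr := (eballE x r0).1 Ox.
  have [b0 b1] := kK n (normsq x) (introT andP (conj (normsq_ge0 x) (ltW xr))).
  have := toroidal_bound i r0 K0 (ltW xr) b0; have := poloidal_bound i r0 K0 (ltW xr) b0 b1.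
  by lra.
Qed.

(** E is a limit of smooth fields that vanish off the ball, to which green
    applies. *)
Lemma mode_trace (phi : P -> 'rV[R]_3) : (forall i, smooth (fun x => phi x ord0 i)) ->
  Rintegral (@leb3 R) Om
    (fun x => dot3 (modeH x) (phi x) - dot3 (modeE x) (curl phi x)) = 0.
Proof.
move=> sphi.
have [k [Ck k0 [K K0 kK] kE]] := approx_trace Cg Ce B1 ge1 ge1' er.
have cphi i : continuous (fun x => phi x ord0 i) by exact: smooth_continuous.
have ccurl := continuous_curl sphi.
have [M M0 HM] := bounded_on_eball r0 cphi; have [M' M'0 HM'] := bounded_on_eball r0 ccurl.
have cE n i : continuous (fun x => toroidal (k n) x ord0 i).
  exact: elementary_continuous (elementary_toroidal i (Ck n)).
have cH n i : continuous (fun x => poloidal (k n) (der (k n)) x ord0 i).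
  have := elementary_continuous (elementary_curl i (fun j => elementary_toroidal j (Ck n))).
  by rewrite curl_toroidal.
have rK : 0 <= r * K by rewrite mulr_ge0// ltW.
have rrK : 0 <= r * r * K by rewrite !mulr_ge0// ltW.
pose C := 3 * ((2 * K + 4 * (r * r * K)) * M) + 3 * (r * K * M').
apply: (@Rintegral_limit0 _ _ _ _ Om mOm (fun n x =>
    dot3 (poloidal (k n) (der (k n)) x) (phi x)
    - dot3 (toroidal (k n) x) (curl phi x)) _ (fun=> C)).
- move=> n; apply: measurable_funB; apply: continuous_measurable_on;
    exact: continuous_dot3.
- move=> x /(eballE _ r0) xr; apply: filterS (kE _ xr) => n [h0 h1].
  by rewrite /modeE /modeH /toroidal /poloidal h0 h1.
- by apply: (@integrable_bounded _ _ _ _ _ mOm Omfin _ `|C|).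
- move=> n x Ox; have xr := (eballE x r0).1 Ox.
  have [b0 b1] := kK n (normsq x) (introT andP (conj (normsq_ge0 x) (ltW xr))).
  rewrite (le_trans (ler_normB _ _))// lerD//.
    apply: dot3_bound => //; [lra| |by move=> i; exact: HM].
    by move=> i; exact: poloidal_bound (ltW xr) b0 b1.
  apply: dot3_bound => //; last by move=> i; exact: HM'.
  by move=> i; exact: toroidal_bound (ltW xr) b0.
- move=> n; rewrite Rintegral_mkcond.
  have out x : ~ Om x -> toroidal (k n) x = 0 /\ poloidal (k n) (der (k n)) x = 0.
    move=> nO; have Bq : r ^+ 2 <= normsq x.
      by rewrite leNgt; apply/negP => xr; apply: nO; exact: (eballE x r0).2.
    have [z0 z1] := k0 n _ Bq; rewrite /toroidal /poloidal z0 z1 !(mulr0, oppr0, addr0).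
    by split; apply/esym/vec3P; rewrite mxE.
  rewrite (_ : _ \_ _ = fun x =>
    dot3 (curl (toroidal (k n)) x) (phi x) - dot3 (toroidal (k n) x) (curl phi x)).
    apply: (@green _ _ _ r) => //; first by move=> i; exact: elementary_toroidal.
    move=> x bx; apply: (out x _).1 => /(eballE _ r0) xr; apply: bx.
    by apply: normsq_box3; exact: ltW.
  apply/funext => x; rewrite patchE; case: ifPn => [_|]; first by rewrite curl_toroidal.
  move=> /negP; rewrite inE => /out[z0 z1].
  rewrite curl_toroidal// z0 z1 /dot3 !big1 ?subrr// => i _; by rewrite mxE mul0r.
Qed.

(** The trace condition on u, with weak curl v, is tested with the smooth fields
    Phi n that approximate H; their curls approximate lambda E inside the unit
    ball and 0 outside. *)
Lemma mode_eigen (u v : P -> 'rV[R]_3) :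
  (forall i, (fun x => u x ord0 i) \_ Om \in Lfun (@leb3 R) 2%:E) ->
  (forall i, (fun x => v x ord0 i) \_ Om \in Lfun (@leb3 R) 2%:E) ->
  (forall phi, test_field setT phi -> Rintegral (@leb3 R) Om
     (fun x => dot3 (v x) (phi x) - dot3 (u x) (curl phi x)) = 0) ->
  [/\ (@leb3 R).-integrable Om (EFin \o (fun x => dot3 (modeH x) (v x))),
      (@leb3 R).-integrable (eball 1 : set MP)
        (EFin \o (fun x => dot3 (modeE x) (u x)))
    & Rintegral (@leb3 R) Om (fun x => dot3 (modeH x) (v x)) =
      lam * Rintegral (@leb3 R) (eball 1 : set MP) (fun x => dot3 (modeE x) (u x))].
Proof.
move=> Lu Lv uv.
have Iu i := Lfun2_integrable mOm Omfin (Lu i).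
have Iv i := Lfun2_integrable mOm Omfin (Lv i).
have mu i := (measurable_EFinP _ _).1 (measurable_int _ (Iu i)).
have mv i := (measurable_EFinP _ _).1 (measurable_int _ (Iv i)).
have [h [Ch h0 [K K0 hK] hE]] := approx_test Cg Ce B1 ge1 ge1'.
pose Phi n := poloidal (h n) (der (h n)).
have ePhi n i : elementary (fun x => Phi n x ord0 i).
  rewrite /Phi -curl_toroidal//; apply: elementary_curl => j; exact: elementary_toroidal.
have tPhi n : test_field setT (Phi n).
  have sub : closure [set x | Phi n x != 0] `<=` (box3 (r ^+ 2 + 1) : set P).
    rewrite [X in _ `<=` X]((closure_id _).1 (@closed_box3 R _)).
    apply: closureS => x /= Px; apply: normsq_box3; first by rewrite addr_ge0 ?sqr_ge0.
    have [|xB] := leP (normsq x) (r ^+ 2 + 1); first by move=> xB; have := sqr_ge0 r; nra.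
    exfalso; move/eqP: Px; apply.
    have z0 : h n (normsq x) = 0 by apply: h0; exact: ltW.
    have z1 : der (h n) (normsq x) = 0.
      by apply: (@der_cst_gt _ _ 0 (r ^+ 2 + 1)) => // t tB; apply: h0; exact: ltW.
    by rewrite /Phi /poloidal z0 z1 !(mulr0, oppr0, addr0); apply/esym/vec3P; rewrite mxE.
  split => //; first by move=> i; exact: elementary_smooth.
  by apply: subclosed_compact sub; [exact: closed_closure|exact: compact_box3].
pose w n := fun q => - (4 * q * der (der (h n)) q + 10 * der (h n) q).
have cPhi n i : continuous (fun x => Phi n x ord0 i) by exact: elementary_continuous.
have curlPhi n : curl (Phi n) = toroidal (w n) by exact: curl_poloidal.
have cw n i : continuous (fun x => toroidal (w n) x ord0 i).
  by rewrite -curlPhi; exact: (elementary_continuous (elementary_curl i (ePhi n))).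
pose bH := 2 * K + 4 * (r * r * K).
pose bw := r * (4 * (r ^+ 2 * K) + 10 * K).
pose G x := 3 * (bH * \sum_(i < 3) `|v x ord0 i|) + 3 * (bw * \sum_(i < 3) `|u x ord0 i|).
pose D := eball 1 : set MP.
have mD : measurable D by apply: measurable_eball.
have rrK : 0 <= r * r * K by rewrite !mulr_ge0// ltW.
have bH0 : 0 <= bH by rewrite /bH; lra.
have B0 : 0 <= r ^+ 2 by rewrite sqr_ge0.
have r2K : 0 <= r ^+ 2 * K by rewrite mulr_ge0.
have bw0 : 0 <= bw.
  by rewrite /bw; apply: mulr_ge0; [exact: ltW|lra].
have le_sum (a : 'I_3 -> R) i : `|a i| <= \sum_(j < 3) `|a j|.
  rewrite sum3E; have := normr_ge0 (a i0); have := normr_ge0 (a i1).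
  have := normr_ge0 (a i2); by elim/ord3_ind : i; lra.
have sum0 (a : 'I_3 -> R) : 0 <= \sum_(j < 3) `|a j| by apply: sumr_ge0.
have lim0 : Rintegral (@leb3 R) Om (fun x => dot3 (modeH x) (v x) -
    ((fun y => lam * dot3 (modeE y) (u y)) \_ D) x) = 0.
  apply: (@Rintegral_limit0 _ _ _ _ Om mOm (fun n x =>
    dot3 (v x) (Phi n x) - dot3 (u x) (curl (Phi n) x)) _ G).
  - move=> n; rewrite curlPhi.
    by apply: measurable_funB; apply: measurable_dot3 => // i;
      apply: continuous_measurable_on.
  - move=> x /(eballE _ r0) xr; apply: filterS (hE _ xr) => n [e0 e1 e2].
    rewrite curlPhi; congr (_ - _).
      rewrite /dot3; apply: eq_bigr => i _; rewrite mulrC; congr (_ * _).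
      by rewrite /Phi /modeH /poloidal e0 e1.
    rewrite patchE.
    have wE : w n (normsq x) = if normsq x < 1 then
        - (4 * normsq x * der (der g) (normsq x) + 10 * der g (normsq x)) else 0.
      rewrite /w e1 e2 /piecewise; case: ltP => // x1.
      by rewrite odee// oppr0.
    have DE : (x \in D) = (normsq x < 1).
      apply/idP/idP; first by rewrite inE => /(eballE _ ltr01); rewrite expr1n.
      by move=> x1; rewrite inE; apply/(eballE _ ltr01); rewrite expr1n.
    rewrite DE; case: ifPn => x1; last first.
      rewrite (_ : toroidal (w n) x = 0).
        by rewrite /dot3 big1// => i _; rewrite mxE mulr0.
      by apply/esym/vec3P; rewrite mxE ?wE ?(negbTE x1) ?mulr0 ?oppr0.
    rewrite (_ : toroidal (w n) x = lam *: modeE x).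
      rewrite /dot3 mulr_sumr; apply: eq_bigr => i _; rewrite mxE; ring.
    have sc a b : vec3 (- (lam * a)) (lam * b) 0 = lam *: vec3 (- a) b 0.
      have [v0 v1 v2] := vec3E (- a) b 0.
      by apply/esym/vec3P; rewrite mxE ?v0 ?v1 ?v2 ?mulr0 ?mulrN.
    rewrite /modeE /toroidal -sc /piecewise x1.
    have [q0|] := ltP 0 (normsq x).
      by rewrite wE x1 odeg//; congr vec3; ring.
    (* At the origin, where the interior equation is not available, E is 0. *)
    move=> q0; have z i : crd i x = 0.
      have := @crd_le _ i x 0 (lexx _); rewrite expr0n/= => /(_ q0).
      by rewrite normr_le0 => /eqP.
    by rewrite !z !(mul0r, mulr0).
  - have In (a : P -> 'rV[R]_3) : (forall i, (@leb3 R).-integrable Om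
        (EFin \o (fun x => a x ord0 i))) -> (@leb3 R).-integrable Om
        (EFin \o (fun x => \sum_(i < 3) `|a x ord0 i|)).
      move=> Ia; rewrite (_ : _ \o _ = EFin \o (fun x => `|a x ord0 i0| +
        `|a x ord0 i1| + `|a x ord0 i2|)); last first.
        by apply/funext => x /=; rewrite sum3E.
      by do 2?apply: integrable_add => //; apply: integrable_norm.
    have Z c (f : P -> R) : (@leb3 R).-integrable Om (EFin \o f) ->
        (@leb3 R).-integrable Om (EFin \o (fun x => c * f x)).
      move=> If; rewrite (_ : _ \o _ = fun x => (c%:E * (EFin \o f) x)%E).
        exact: integrableZl.
      by apply/funext => x /=; rewrite EFinM.
    by apply: integrable_add => //; do 2!apply: (Z); exact: In.
  - move=> n x Ox; have xr := (eballE x r0).1 Ox.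
    have [b0 b1 b2] := hK n (normsq x) (introT andP (conj (normsq_ge0 x) xr)).
    rewrite curlPhi (le_trans (ler_normB _ _))// lerD//.
      rewrite (mulrC bH); apply: (dot3_bound (sum0 (fun i => v x ord0 i)) bH0).
        exact: (le_sum (fun i => v x ord0 i)).
      by move=> i; exact: poloidal_bound (ltW xr) b0 b1.
    rewrite (mulrC bw); apply: (dot3_bound (sum0 (fun i => u x ord0 i)) bw0).
      exact: (le_sum (fun i => u x ord0 i)).
    move=> i; apply: toroidal_bound (ltW xr) _ => //; first lra.
    rewrite /w normrN (le_trans (ler_normD _ _))// lerD//.
      rewrite -mulrA normrM (@ger0_norm _ 4)// ler_wpM2l// normrM ler_pM//.
      by rewrite ger0_norm ?normsq_ge0// ltW.
    by rewrite normrM (@ger0_norm _ 10)// ler_wpM2l.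
  - by move=> n; exact: uv.
have [Km Km0 reg] := mode_regular.
have Idot (a b : P -> 'rV[R]_3) : (forall i, (@leb3 R).-integrable Om
      (EFin \o (fun x => b x ord0 i))) ->
    (forall i, measurable_fun Om ((fun x => a x ord0 i) : MP -> MR)) ->
    (forall i x, Om x -> `|a x ord0 i| <= Km) ->
    (@leb3 R).-integrable Om (EFin \o (fun x => dot3 (a x) (b x))).
  move=> Ib ma ba; rewrite (_ : _ \o _ = EFin \o (fun x => b x ord0 i0 * a x ord0 i0 +
    b x ord0 i1 * a x ord0 i1 + b x ord0 i2 * a x ord0 i2)); last first.
    by apply/funext => x /=; rewrite /dot3 sum3E !(mulrC (a x _ _)).
  have T i : (@leb3 R).-integrable Om (EFin \o (fun x => b x ord0 i * a x ord0 i)).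
    exact: (integrable_mul_bounded mOm (Ib i) (ma i) (ba i)).
  exact: (integrable_add mOm (integrable_add mOm (T i0) (T i1)) (T i2)).
have IH : (@leb3 R).-integrable Om (EFin \o (fun x => dot3 (modeH x) (v x))).
  apply: Idot => // i; first by have [] := reg i.
  by move=> x Ox; have [_ _ /(_ x Ox)[]] := reg i.
have IE : (@leb3 R).-integrable Om (EFin \o (fun x => dot3 (modeE x) (u x))).
  apply: Idot => // i; first by have [] := reg i.
  by move=> x Ox; have [_ _ /(_ x Ox)[]] := reg i.
have DO : D `<=` Om.
  move=> x /(eballE _ ltr01); rewrite expr1n => x1; apply/(eballE _ r0).
  exact: lt_trans B1.
have IED := integrableS mOm mD DO IE.
have IlE : (@leb3 R).-integrable D (EFin \o (fun x => lam * dot3 (modeE x) (u x))).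
  rewrite (_ : _ \o _ = fun x => (lam%:E * (EFin \o fun x => dot3 (modeE x) (u x)) x)%E).
    exact: integrableZl.
  by apply/funext => x /=; rewrite EFinM.
split => //; move: lim0; rewrite RintegralB//; last first.
  rewrite -restrict_EFin; apply/integrable_restrict => //.
  by rewrite setIC (setIidl DO).
rewrite -Rintegral_mkcondr (setIidr DO) RintegralZl// => /eqP.
by rewrite subr_eq0 => /eqP.
Qed.

End Mode.

(** * Complex fields and the theorem *)

Local Open Scope complex_scope.

Section Complexify.
Variable R : realType.
Notation P := (R * R * R)%type.
Notation MR := (measurableTypeR R).
Notation MP := (MR * MR * MR)%type.

Definition complexify (u : 'rV[R]_3) : 'rV[R[i]]_3 := \row_(i < 3) (u ord0 i)%:C.
Definition reV (u : 'rV[R[i]]_3) : 'rV[R]_3 := \row_(i < 3) complex.Re (u ord0 i).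
Definition imV (u : 'rV[R[i]]_3) : 'rV[R]_3 := \row_(i < 3) complex.Im (u ord0 i).

Lemma complexifyE u i : complexify u ord0 i = (u ord0 i)%:C.
Proof. by rewrite mxE. Qed.

Lemma reV_complexify u : reV (complexify u) = u.
Proof. by apply/rowP => i; rewrite !mxE. Qed.

Lemma imV_complexify u : imV (complexify u) = 0.
Proof. by apply/rowP => i; rewrite !mxE. Qed.

Lemma dot30l (v : 'rV[R]_3) : dot3 0 v = 0.
Proof. by rewrite /dot3 big1// => i _; rewrite mxE mul0r. Qed.

Lemma rdotE (u : 'rV[R[i]]_3) v : rdot u v = dot3 (reV u) v +i* dot3 (imV u) v.
Proof.
rewrite /rdot /dot3 !sum3E !mxE.
by case: (u ord0 i0) (u ord0 i1) (u ord0 i2) => [a0 b0] [a1 b1] [a2 b2] /=; simpc.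
Qed.

Lemma hdotE u (v : 'rV[R[i]]_3) :
  hdot (complexify u) v = dot3 u (reV v) +i* (- dot3 u (imV v)).
Proof.
rewrite /hdot /dot3 !sum3E !mxE.
case: (v ord0 i0) (v ord0 i1) (v ord0 i2) => [a0 b0] [a1 b1] [a2 b2] /=; simpc.
by congr (_ +i* _); ring.
Qed.

Lemma rdot_complexify (u v : 'rV[R]_3) : rdot (complexify u) v = (dot3 u v)%:C.
Proof. by rewrite rdotE reV_complexify imV_complexify dot30l. Qed.

Lemma cintegral_parts (A : set P) (f h : P -> R) :
  cintegral A (fun x => f x +i* h x) =
  Rintegral (@leb3 R) A f +i* Rintegral (@leb3 R) A h.
Proof. by []. Qed.

Lemma cintegral_real (A : set P) (f : P -> R) :
  cintegral A (fun x => (f x)%:C) = (Rintegral (@leb3 R) A f)%:C.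
Proof.
rewrite cintegral_parts; congr (_ +i* _).
by rewrite /Rintegral integral0_eq.
Qed.

Lemma Rintegral_opp (A : set MP) (f : P -> R) : measurable A ->
  (@leb3 R).-integrable A (EFin \o f) ->
  Rintegral (@leb3 R) A (fun x => - f x) = - Rintegral (@leb3 R) A f.
Proof.
move=> mA If; rewrite -mulN1r -RintegralZl//.
by congr (Rintegral _ _ _); apply/funext => x; rewrite mulN1r.
Qed.

(** A box inside the shell 1 < |x| < r when r = 1 + 2 s, and on which no
    coordinate vanishes. *)
Definition probe (s : R) : set MP :=
  (`]1, 1 + s[ `*` `]0, s[) `*` `]0, s[.

Lemma measurable_probe s : measurable (probe s).
Proof. by do 2?apply: measurableX; exact: measurable_itv. Qed.

Lemma probe_gt0 s : 0 < s -> (0 < @leb3 R (probe s))%E.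
Proof.
move=> s0.
have len (a b : R) : a < b -> (0 < @lebesgue_measure R `]a, b[)%E.
  by move=> ab; rewrite lebesgue_measure_itv/= lte_fin ab -EFinB lte_fin subr_gt0.
have L2 : (0 < @leb2 R (`]1%R, (1 + s)%R[ `*` `]0%R, s[))%E.
  rewrite /leb2 product_measure1E; [|exact: measurable_itv|exact: measurable_itv].
  by apply: mule_gt0; apply: len; lra.
rewrite /leb3 product_measure1E; [| |exact: measurable_itv]; last first.
  by apply: measurableX; exact: measurable_itv.
by apply: mule_gt0; [exact: L2|apply: len; lra].
Qed.

(** The box has positive measure, so that it is not contained in a null set. *)
Lemma not_ae_zero (A : set P) (V : P -> 'rV[R[i]]_3) s : 0 < s ->
  (forall x, probe s x -> A x /\ V x <> 0) -> ~ ae_zero A V.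
Proof.
move=> s0 H [N [mN N0 sN]]; have := probe_gt0 s0; apply/negP; rewrite -leNgt -N0.
apply: le_measure; rewrite ?inE//; first exact: measurable_probe.
by move=> x /H[Ax Vx]; apply: sN => /= /(_ Ax).
Qed.

Lemma probeP s (x : P) : probe s x ->
  [/\ 1 < crd i0 x < 1 + s, 0 < crd i1 x < s & 0 < crd i2 x < s].
Proof.
have inI (a b v : R) : `]a, b[%classic v -> a < v < b by rewrite /= in_itv.
by case=> -[] /inI ? /inI ? /inI ?; split.
Qed.

Lemma closure_eball1 (x : P) : closure (eball 1) x -> normsq x <= 1.
Proof.
move=> cx; have cl : closed ((@normsq R) @^-1` [set t | t <= 1]).
  by apply: preimage_closed; [move=> y _; exact: normsq_continuous|exact: closed_le].
suff : ((@normsq R) @^-1` [set t | t <= 1]) x by [].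
rewrite ((closure_id _).1 cl); apply: closureS cx => y.
by move/(eballE _ ltr01); rewrite expr1n => /ltW.
Qed.

End Complexify.

Theorem theorem4p5 (R : realType) (r : R) (hr : 1 < r) :
  exists (lam : R) (E H : R * R * R -> 'rV[R[i]]_3),
    [/\ lam != 0,
        eigenfunction (eball r) (eball 1) lam%:C E H &
        ~ ae_zero (eball r `\` closure (eball 1)) H].
Proof.
have [lam [g [e [lam0 [Cg Ce] odeg odee [ge1 ge1' er e0 e'0]]]]] := exists_profile hr.
have r0 : 0 < r by lra.
pose MP := (measurableTypeR R * measurableTypeR R * measurableTypeR R)%type.
pose E := modeE g e; pose H := modeH g e.
pose Om := eball r : set MP.
have mOm : measurable Om by exact: measurable_eball.
have Omfin : (@leb3 R Om < +oo)%E by exact: leb3_eball.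
have [K K0 reg] := mode_regular hr Cg Ce ge1 ge1' er.
have tr (phi : R * R * R -> 'rV[R]_3) : (forall i, smooth (fun x => phi x ord0 i)) ->
    Rintegral (@leb3 R) Om (fun x => dot3 (H x) (phi x) - dot3 (E x) (curl phi x)) = 0.
  by move=> sphi; exact: mode_trace.
exists lam, (fun x => complexify (E x)), (fun x => complexify (H x)).
pose s := (r - 1) / 2; have s0 : 0 < s by rewrite /s; lra.
(* r = 1 + 2 s, and (1 + s)^2 + 2 s^2 < (1 + 2 s)^2 *)
have prb x : probe s x -> [/\ 1 < normsq x < r ^+ 2, 0 < crd i0 x & 0 < crd i2 x].
  move=> /probeP[/andP[a0 a1] /andP[b0 b1] /andP[c0 c1]].
  split; [|lra|lra]; have rs : r = 1 + 2 * s by rewrite /s; lra.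
  rewrite rs /normsq; move: a0 a1 b0 b1 c0 c1 s0.
  move: (crd i0 x) (crd i1 x) (crd i2 x) s {rs} => x0 x1 x2 s *.
  by apply/andP; split; nra.
have neqE x : probe s x -> complexify (E x) <> 0.
  move=> /prb[/andP[q1 qr] x0 x2] /(congr1 (fun V : 'rV[R[i]]_3 => complex.Re (V ord0 i1))).
  have [_ e1 _] := vec3E (- (crd i1 x * piecewise g e (normsq x)))
    (crd i0 x * piecewise g e (normsq x)) 0.
  rewrite complexifyE [E x ord0 i1]e1 mxE /piecewise ltNge (ltW q1)/= => /eqP; apply/negP.
  by rewrite mulf_neq0 ?(lt0r_neq0 x0)// e0// (ltW q1).
have neqH x : probe s x -> complexify (H x) <> 0.
  move=> /prb[/andP[q1 qr] x0 x2] /(congr1 (fun V : 'rV[R[i]]_3 => complex.Re (V ord0 i0))).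
  have h0 : H x ord0 i0 =
      - (2 * (crd i0 x * crd i2 x * piecewise (der g) (der e) (normsq x))).
    by rewrite /H /modeH /poloidal mxE.
  rewrite complexifyE h0 mxE /piecewise ltNge (ltW q1)/= => /eqP; apply/negP.
  by rewrite oppr_eq0 !mulf_neq0 ?(lt0r_neq0 x0) ?(lt0r_neq0 x2) ?e'0 ?pnatr_eq0// ltW.
have inOm x : probe s x -> Om x.
  by move=> /prb[/andP[_ qr] _ _]; apply/(eballE _ r0).2.
have re_complexify (U : R * R * R -> 'rV[R]_3) i :
    (fun x => complex.Re (complexify (U x) ord0 i)) = fun x => U x ord0 i.
  by apply/funext => x; rewrite complexifyE.
have im_complexify (U : R * R * R -> 'rV[R]_3) i :
    (fun x => complex.Im (complexify (U x) ord0 i)) = fun=> 0.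
  by apply/funext => x; rewrite complexifyE.
have L0 : (fun=> 0 : R) \_ Om \in Lfun (@leb3 R) 2%:E.
  by apply: (Lfun2_bounded mOm Omfin (K := 0)) => // x _; rewrite normr0.
split; first by rewrite gt_eqF.
  split; first split.
  - move=> i; have [mE _ b] := reg i; rewrite re_complexify im_complexify.
    split; last exact: L0.
    by apply: (Lfun2_bounded mOm Omfin (K := K)) => // x /b[].
  - move=> i; have [_ mH b] := reg i; rewrite re_complexify im_complexify.
    split; last exact: L0.
    by apply: (Lfun2_bounded mOm Omfin (K := K)) => // x /b[].
  - move=> phi [sphi _ _].
    under eq_fun do rewrite rdot_complexify.
    under [in RHS]eq_fun do rewrite rdot_complexify.
    rewrite !cintegral_real; congr (_%:C).
    have cphi i : continuous (fun x => phi x ord0 i) by exact: smooth_continuous.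
    have ccurl := continuous_curl sphi.
    have [M M0 HM] := bounded_on_eball r0 cphi.
    have [M' M'0 HM'] := bounded_on_eball r0 ccurl.
    have I1 : (@leb3 R).-integrable Om (EFin \o (fun x => dot3 (H x) (phi x))).
      apply: (integrable_bounded mOm Omfin (K := 3 * (K * M))).
        apply: measurable_dot3 => i; first by have [] := reg i.
        exact: continuous_measurable_on.
      move=> x Ox; apply: dot3_bound => // i; last exact: HM.
      by have [_ _ /(_ x Ox)[]] := reg i.
    have I2 : (@leb3 R).-integrable Om (EFin \o (fun x => dot3 (E x) (curl phi x))).
      apply: (integrable_bounded mOm Omfin (K := 3 * (K * M'))).
        apply: measurable_dot3 => i; first by have [] := reg i.
        exact: continuous_measurable_on.
      move=> x Ox; apply: dot3_bound => // i; last exact: HM'.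
      by have [_ _ /(_ x Ox)[]] := reg i.
    by have := tr phi sphi; rewrite RintegralB// => /eqP; rewrite subr_eq0 => /eqP.
  - move=> phi [sphi _ _]; rewrite /tangential_trace.
    rewrite [X in cintegral _ X](_ : _ =
      fun x => (dot3 (H x) (phi x) - dot3 (E x) (curl phi x))%:C).
      by rewrite cintegral_real tr.
    by apply/funext => x; rewrite !rdot_complexify rmorphB.
  - by apply: (not_ae_zero s0) => x px; split; [exact: inOm|exact: neqE].
  - move=> F G [LF LG _ tFG].
    have tparts phi : test_field setT phi ->
        Rintegral (@leb3 R) Om (fun x => dot3 (reV (G x)) (phi x)
          - dot3 (reV (F x)) (curl phi x)) = 0 /\
        Rintegral (@leb3 R) Om (fun x => dot3 (imV (G x)) (phi x)
          - dot3 (imV (F x)) (curl phi x)) = 0.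
      move=> /tFG; rewrite /tangential_trace.
      rewrite [X in cintegral _ X](_ : _ = fun x =>
        (dot3 (reV (G x)) (phi x) - dot3 (reV (F x)) (curl phi x)) +i*
        (dot3 (imV (G x)) (phi x) - dot3 (imV (F x)) (curl phi x))).
        by rewrite cintegral_parts => -[].
      by apply/funext => x; rewrite !rdotE.
    have reE (V : R * R * R -> 'rV[R[i]]_3) i :
        (fun x => reV (V x) ord0 i) = fun x => complex.Re (V x ord0 i).
      by apply/funext => x; rewrite mxE.
    have imE (V : R * R * R -> 'rV[R[i]]_3) i :
        (fun x => imV (V x) ord0 i) = fun x => complex.Im (V x ord0 i).
      by apply/funext => x; rewrite mxE.
    have [I1 J1 eq1] : [/\ _, _ & _] := mode_eigen hr Cg Ce ge1 ge1' er odeg odee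
      (u := fun x => reV (F x)) (v := fun x => reV (G x))
      (fun i => eq_ind_r (fun f => f \_ Om \in Lfun _ _) (LF i).1 (reE F i))
      (fun i => eq_ind_r (fun f => f \_ Om \in Lfun _ _) (LG i).1 (reE G i))
      (fun phi tphi => (tparts phi tphi).1).
    have [I2 J2 eq2] : [/\ _, _ & _] := mode_eigen hr Cg Ce ge1 ge1' er odeg odee
      (u := fun x => imV (F x)) (v := fun x => imV (G x))
      (fun i => eq_ind_r (fun f => f \_ Om \in Lfun _ _) (LF i).2 (imE F i))
      (fun i => eq_ind_r (fun f => f \_ Om \in Lfun _ _) (LG i).2 (imE G i))
      (fun phi tphi => (tparts phi tphi).2).
    under eq_fun do rewrite hdotE.
    under [in RHS]eq_fun do rewrite hdotE.
    rewrite !cintegral_parts !Rintegral_opp//; last exact: measurable_eball.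
    by rewrite eq1 eq2; simpc.
apply: (not_ae_zero s0) => x px; split; last exact: neqH.
split; first exact: inOm.
move=> /closure_eball1; apply/negP; rewrite -ltNge.
by have [/andP[]] := prb x px.
Qed.
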